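(* The following is provable in $\mathrm{BZFC}$: for all sets $A$ and $B$, 1. $A\preceq B$ iff $\mathrm{rlm}(A)\preceq\mathrm{rlm}(B)$ and $A^!\preceq B^!$ and $A^?\preceq B^?$ and $A_{\mathbf t}\preceq B_{\mathbf t}$; 2. $A\not\preceq B$ iff $A^!\not\preceq B^?$; 3. $A\cong B$ iff $A_{\mathbf t}\cong B_{\mathbf t}$ and $A_{\mathbf b}\cong B_{\mathbf b}$ and $A_{\mathbf n}\cong B_{\mathbf n}$; 4. $A\not\cong B$ iff $A^!\not\preceq B^?$ or $B^!\not\preceq A^?$ or $A_{\mathbf b}\not\preceq B_{\mathbf n}$ or $B_{\mathbf b}\not\preceq A_{\mathbf n}$.
   Context: Logic. The background logic is the four-valued first-order logic BS4 with primitives $\sim,\land,\lor,\rightarrow,\leftrightarrow,\bot,\forall,\exists$. A model has a non-empty domain $M$, the usual interpretations of constants and function symbols, and, for each $n$-ary relation symbol $R$, two independent interpretations $R^+,R^-\subseteq M^n$; $=^+$ is true identity and $=^-$ is a symmetric relation. Truth and falsity are defined simultaneously (a formula may be true, false, both, or neither): an atomic formula is true/false according to $R^+$/$R^-$; $\sim\varphi$ is true iff $\varphi$ is false, and false iff $\varphi$ is true; $\varphi\land\psi$ is true iff both are true, false iff at least one is false; $\lor$ dually; $\varphi\rightarrow\psi$ is true iff ($\varphi$ true implies $\psi$ true), false iff $\varphi$ is true and $\psi$ is false; $\varphi\leftrightarrow\psi$ is true iff ($\varphi$ true iff $\psi$ true), false iff ($\varphi$ true and $\psi$ false) or ($\varphi$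 false and $\psi$ true); $\forall$ is true iff all instances are true, false iff some instance is false; $\exists$ is true iff some instance is true, false iff all instances are false; $\bot$ is false and not true. $\Gamma\vDash\varphi$ iff $\varphi$ is true in every model in which all of $\Gamma$ is true. Asserting a formula means asserting that it is true; English ''iff'', ''if/then'', ''and'', ''or'' between formulas concern truth. Abbreviations: $\neg\varphi:=\varphi\rightarrow\bot$ (true iff $\varphi$ is not true); $!\varphi:=\sim\neg\varphi$ (two-valued, true iff $\varphi$ is true); $?\varphi:=\neg\sim\varphi$ (two-valued, true iff $\varphi$ is not false); $\circ\varphi:=\,!\varphi\leftrightarrow ?\varphi$; $\varphi\Rightarrow\psi:=(\varphi\rightarrow\psi)\land(\sim\psi\rightarrow\sim\varphi)$; $\varphi\Leftrightarrow\psi:=(\varphi\leftrightarrow\psi)\land(\sim\varphi\leftrightarrow\sim\psi)$; $\varphi\,\&\,\psi:=\,\sim(\varphi\rightarrow\sim\psi)$; $\exists x\in A\,\varphi:=\exists x(x\in A\,\&\,\varphi)$; $\forall x\in A\,\varphi:=\forall x(x\in A\rightarrow\varphi)$. A slashed relation symbol ($\neq,\notin,\not\subseteq,\not\cong,\not\preceq$) is the $\sim$-negation of the relation. Set theory. $\mathrm{BZFC}$ is a BS4-theory in the language $\{\in,=\}$ whose objects are called sets. It includes: Extensionality $\forall A\forall B(A=B\Leftrightarrow\forall x(x\in A\Leftrightarrow x\in B))$; Comprehension $\forall A\exists B\forall x(x\in B\Leftrightarrow x\in A\land\varphi(x))$; ACLA: $\exists A(A^!\not\subseteq A^?)\land\exists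 A(A^?\not\subseteq A^!)$; Choice: every classical set of non-empty sets has a choice function. Here $A=\{x:\varphi(x)\}$ means $\forall x(x\in A\Leftrightarrow\varphi(x))$; $A\subseteq B:=\forall x(x\in A\Rightarrow x\in B)$; $A$ is classical if $\forall x\,{\circ}(x\in A)$; $A^!:=\{x:{!}(x\in A)\}$ and $A^?:=\{x:{?}(x\in A)\}$. The remaining axioms are suitable analogues of those of $\mathrm{ZFC}$; available consequences are: $A^!,A^?$ are (classical) sets; $A\subseteq B\leftrightarrow(A^!\subseteq B^!\land A^?\subseteq B^?)$, $A\not\subseteq B\leftrightarrow A^!\not\subseteq B^?$, $A=B\leftrightarrow(A^!=B^!\land A^?=B^?)$, $A\neq B\leftrightarrow(A^!\not\subseteq B^?\lor B^!\not\subseteq A^?)$; for all classical sets $X,Y$ there is a unique set $\langle X|Y\rangle$ with $\langle X|Y\rangle^!=X$, $\langle X|Y\rangle^?=Y$; ordered pairs are encoded so that $(a,b)=(c,d)\Leftrightarrow(a=c\land b=d)$; usual $\mathrm{ZFC}$ set theory (including choice and von Neumann ordinals, which live in the inner $\mathrm{ZFC}$-model of hereditarily classical sets) applies to classical sets, whose elements may be arbitrary sets. Put $A_{\mathbf b}:=A^!\setminus A^?$, $A_{\mathbf t}:=A^!\cap A^?$, $A_{\mathbf n}:=A^?\setminus A^!$, $\mathrm{rlm}(A):=A^!\cup A^?$ (all classical sets). Functions and equinumerosity. A classical function is a classical set $f$ of ordered pairs with $((a,b)\in f\land(a,c)\in f)\rightarrow{!}(b=c)$; it is an injection if $((a,c)\in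 f\land(b,c)\in f)\rightarrow{!}(a=b)$. For $A\subseteq\mathrm{dom}(f)$, $f[A]:=\{y:\exists x(y=f(x)\,\&\,x\in A)\}$, so $f[A]^!=f[A^!]$ and $f[A]^?=f[A^?]$. A counting of $A$ is an injection with domain $\mathrm{rlm}(A)$; $\mathrm{Count}(A)$ is the class of countings of $A$. Define $$A\cong B:=\exists f\in\mathrm{Count}(A)\,\exists g\in\mathrm{Count}(B)\,(f[A]=g[B]),$$ $$A\preceq B:=\exists f\in\mathrm{Count}(A)\,\exists g\in\mathrm{Count}(B)\,(f[A]\subseteq g[B]).$$ Thus $A\not\cong B$ (resp. $A\not\preceq B$) is true iff $f[A]\neq g[B]$ (resp. $f[A]\not\subseteq g[B]$) is true for all $f\in\mathrm{Count}(A)$, $g\in\mathrm{Count}(B)$. For classical sets these notions agree with the usual ones of classical set theory. *)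

(* Defs.v *)
(* Four-valued logic BS4 and the set theory BZFC. *)

(* The semantic value of a formula: truth and falsity are independent. *)
Record tv : Type := TV { truth : Prop; falsity : Prop }.

Declare Scope bs4_scope.
Delimit Scope bs4_scope with bs4.
Bind Scope bs4_scope with tv.
Open Scope bs4_scope.

Definition tbot : tv := TV False True.
Definition tnot (p : tv) : tv := TV (falsity p) (truth p).
Definition tand (p q : tv) : tv :=
  TV (truth p /\ truth q) (falsity p \/ falsity q).
Definition tor (p q : tv) : tv :=
  TV (truth p \/ truth q) (falsity p /\ falsity q).
Definition timp (p q : tv) : tv :=
  TV (truth p -> truth q) (truth p /\ falsity q).
Definition tiff (p q : tv) : tv :=
  TV (truth p <-> truth q)
     ((truth p /\ falsity q) \/ (falsity p /\ truth q)).
Definition tall {T : Type} (P : T -> tv) : tv :=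
  TV (forall x, truth (P x)) (exists x, falsity (P x)).
Definition tex {T : Type} (P : T -> tv) : tv :=
  TV (exists x, truth (P x)) (forall x, falsity (P x)).

Notation "⊥" := tbot : bs4_scope.
Notation "∼ p" := (tnot p) (at level 75, right associativity) : bs4_scope.
Notation "p ∧ q" := (tand p q) (at level 80, right associativity) : bs4_scope.
Notation "p ∨ q" := (tor p q) (at level 85, right associativity) : bs4_scope.
Notation "p → q" := (timp p q)
  (at level 99, q at level 200, right associativity) : bs4_scope.
Notation "p ↔ q" := (tiff p q) (at level 95, no associativity) : bs4_scope.
Notation "∀ x .. y , p" := (tall (fun x => .. (tall (fun y => p)) ..))
  (at level 200, x binder, y binder, right associativity) : bs4_scope.
Notation "∃ x .. y , p" := (tex (fun x => .. (tex (fun y => p)) ..))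
  (at level 200, x binder, y binder, right associativity) : bs4_scope.

Definition tneg (p : tv) : tv := p → ⊥.
Notation "¬ p" := (tneg p) (at level 75, right associativity) : bs4_scope.

(* [bang p], [quest p] and [determined p] are !p, ?p and ∘p. *)
Definition bang (p : tv) : tv := ∼ ¬ p.
Definition quest (p : tv) : tv := ¬ ∼ p.
Definition determined (p : tv) : tv := bang p ↔ quest p.

Definition tImp (p q : tv) : tv := (p → q) ∧ (∼ q → ∼ p).
Notation "p ⇒ q" := (tImp p q)
  (at level 99, q at level 200, right associativity) : bs4_scope.
Definition tIff (p q : tv) : tv := (p ↔ q) ∧ (∼ p ↔ ∼ q).
Notation "p ⇔ q" := (tIff p q) (at level 95, no associativity) : bs4_scope.
Definition tamp (p q : tv) : tv := ∼ (p → ∼ q).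
Notation "p ＆ q" := (tamp p q) (at level 80, right associativity) : bs4_scope.

Record model : Type := Model {
  carrier :> Type;
  carrier_inh : inhabited carrier;
  mem_pos : carrier -> carrier -> Prop;
  mem_neg : carrier -> carrier -> Prop;
  eq_neg : carrier -> carrier -> Prop;
  eq_neg_sym : forall x y, eq_neg x y -> eq_neg y x
}.

(* Formulas of the language {∈, =}, with variables named by natural numbers;
   they are the instances of the axiom schemas. *)
Inductive form : Type :=
  | FMem (i j : nat)
  | FEq (i j : nat)
  | FBot
  | FNot (f : form)
  | FAnd (f g : form)
  | FOr (f g : form)
  | FImp (f g : form)
  | FIff (f g : form)
  | FAll (i : nat) (f : form)
  | FEx (i : nat) (f : form).

Definition assignment (M : model) : Type := nat -> M.

Definition upd {M : model} (rho : assignment M) (i : nat) (a : M) :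
  assignment M := fun j => if Nat.eqb j i then a else rho j.

Definition memv {M : model} (x A : M) : tv :=
  TV (mem_pos M x A) (mem_neg M x A).
Definition eqv {M : model} (x y : M) : tv :=
  TV (x = y) (eq_neg M x y).
Notation "x ≈ y" := (eqv x y) (at level 70, no associativity) : bs4_scope.

Fixpoint eval {M : model} (rho : assignment M) (f : form) : tv :=
  match f with
  | FMem i j => memv (rho i) (rho j)
  | FEq i j => rho i ≈ rho j
  | FBot => ⊥
  | FNot f => ∼ eval rho f
  | FAnd f g => eval rho f ∧ eval rho g
  | FOr f g => eval rho f ∨ eval rho g
  | FImp f g => eval rho f → eval rho g
  | FIff f g => eval rho f ↔ eval rho g
  | FAll i f => ∀ a, eval (upd rho i a) f
  | FEx i f => ∃ a, eval (upd rho i a) f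
  end.

(* Class terms {x : φ(x)}.  Defined terms such as A^! or f[A] are class terms,
   and sets are coerced to classes, so that the notions below apply to both. *)
Definition class (M : model) : Type := M -> tv.
Definition elements {M : model} (A : carrier M) : class M := fun x => memv x A.
Coercion elements : carrier >-> class.

Section Classes.
Context {M : model}.
Implicit Types (A B : class M) (x y a b f : M).

Definition cmem x A : tv := A x.
Local Notation "x ∈ A" := (cmem x A) (at level 70, no associativity).

Definition subset A B : tv := ∀ x, (x ∈ A) ⇒ (x ∈ B).
(* {x : φ} = {x : ψ}; on sets this has the value of ≈ by Extensionality. *)
Definition ceq A B : tv := ∀ x, (x ∈ A) ⇔ (x ∈ B).
Local Notation "A ≐ B" := (ceq A B) (at level 70, no associativity).

Definition classical A : tv := ∀ x, determined (x ∈ A).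

Definition pos_part A : class M := fun x => bang (x ∈ A).
Definition may_part A : class M := fun x => quest (x ∈ A).
Definition union A B : class M := fun x => x ∈ A ∨ x ∈ B.
Definition inter A B : class M := fun x => x ∈ A ∧ x ∈ B.
Definition diff A B : class M := fun x => x ∈ A ∧ ∼ (x ∈ B).

Definition b_part A : class M := diff (pos_part A) (may_part A).
Definition t_part A : class M := inter (pos_part A) (may_part A).
Definition n_part A : class M := diff (may_part A) (pos_part A).
Definition rlm A : class M := union (pos_part A) (may_part A).

Definition empty : class M := fun _ => ⊥.
Definition sing x : class M := fun z => bang (z ≈ x).
(* {∅, {x}} *)
Definition sing' x : class M :=
  fun z => bang (z ≐ empty) ∨ bang (z ≐ sing x).

(* (a,b) = {{x} : x ∈ a} ∪ {{∅,{x}} : x ∈ b}.  With Kuratowski pairs,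
   (a,b) = (c,d) ⇔ (a = c ∧ b = d) would fail for falsity. *)
Definition opair a b : class M :=
  fun z => ∃ x : M, ((z ≐ sing x) ＆ (x ∈ a)) ∨ ((z ≐ sing' x) ＆ (x ∈ b)).

(* (a,b) ∈ f *)
Definition pair_in a b f : tv := ∃ p : M, (p ≐ opair a b) ＆ (p ∈ f).

Definition is_function f : tv :=
  classical f
  ∧ (∀ p : M, p ∈ f → ∃ a b, p ≐ opair a b)
  ∧ (∀ a b c : M, pair_in a b f ∧ pair_in a c f → bang (b ≈ c)).

Definition is_injection f : tv :=
  is_function f
  ∧ (∀ a b c : M, pair_in a c f ∧ pair_in b c f → bang (a ≈ b)).

Definition dom f : class M := fun x => ∃ y, pair_in x y f.

Definition image f A : class M := fun y => ∃ x, pair_in x y f ＆ (x ∈ A).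

Definition counting A f : tv := is_injection f ∧ (dom f ≐ rlm A).

Definition equinumerous A B : tv :=
  ∃ f, counting A f ＆ ∃ g, counting B g ＆ (image f A ≐ image g B).

Definition dominated A B : tv :=
  ∃ f, counting A f ＆ ∃ g, counting B g ＆ subset (image f A) (image g B).

End Classes.

Notation "x ∈ A" := (cmem x A) (at level 70, no associativity) : bs4_scope.
Notation "A ⊆ B" := (subset A B) (at level 70, no associativity) : bs4_scope.
Notation "A ≐ B" := (ceq A B) (at level 70, no associativity) : bs4_scope.
Notation "A ^!" := (pos_part A) (at level 1, format "A ^!") : bs4_scope.
Notation "A ^?" := (may_part A) (at level 1, format "A ^?") : bs4_scope.
Notation "A ≅ B" := (equinumerous A B)
  (at level 70, no associativity) : bs4_scope.
Notation "A ⪯ B" := (dominated A B) (at level 70, no associativity) : bs4_scope.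
Notation "A ≇ B" := (∼ (A ≅ B)) (at level 70, no associativity) : bs4_scope.
Notation "A ⋠ B" := (∼ (A ⪯ B)) (at level 70, no associativity) : bs4_scope.

(* M is a model of BZFC.  In the schemas the variable 0 (and 1) is the
   displayed one; the other variables are parameters, given by rho. *)
Record BZFC (M : model) : Prop := {
  ax_extensionality :
    truth (∀ A B : M, A ≈ B ⇔ ∀ x : M, x ∈ A ⇔ x ∈ B);

  ax_comprehension : forall (phi : form) (rho : assignment M),
    truth (∀ A : M, ∃ B : M, ∀ x : M,
      x ∈ B ⇔ x ∈ A ∧ eval (upd rho 0 x) phi);

  ax_classical_superset :
    truth (∀ A : M, ∃ C : M, classical C ∧ A ⊆ C);

  (* {x : x = a ∨ x = b} without bang is in general a proper class, because
     there is a proper class of x for which x = a is not false *)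
  ax_pairing :
    truth (∀ a b : M, ∃ C : M, ∀ x : M,
      x ∈ C ⇔ bang (x ≈ a) ∨ bang (x ≈ b));

  ax_union :
    truth (∀ A : M, ∃ B : M, ∀ x : M,
      x ∈ B ⇔ ∃ y : M, y ∈ A ∧ x ∈ y);

  (* bang is needed for the same reason as in Pairing *)
  ax_power_set :
    truth (∀ A : M, ∃ P : M, ∀ x : M, x ∈ P ⇔ bang (x ⊆ A));

  ax_infinity :
    truth (∃ I : M,
      (∃ e : M, e ∈ I ＆ (e ≐ empty))
      ∧ (∀ x : M, x ∈ I → ∃ y : M, y ∈ I ＆ (y ≐ union x (sing x))));

  (* phi defines a function F on rlm(A); the set is F[A], so that
     F[A]^! = F[A^!] and F[A]^? = F[A^?] *)
  ax_replacement : forall (phi : form) (rho : assignment M),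
    truth (∀ A : M,
      (∀ x : M, x ∈ rlm A →
         ∃ y : M, ∀ z : M, eval (upd (upd rho 0 x) 1 z) phi ↔ z ≈ y) →
      ∃ B : M, ∀ y : M,
        y ∈ B ⇔ ∃ x : M, eval (upd (upd rho 0 x) 1 y) phi ＆ (x ∈ A));

  ax_foundation :
    truth (∀ C : M, classical C ∧ (∃ x : M, x ∈ C) →
      ∃ x : M, x ∈ C ＆ ∀ y : M, y ∈ C → ¬ (y ∈ rlm x));

  ax_choice :
    truth (∀ A : M, classical A ∧ (∀ x : M, x ∈ A → ∃ y : M, y ∈ x) →
      ∃ f : M, is_function f ∧ (dom f ≐ A)
        ∧ ∀ x : M, x ∈ A → ∃ y : M, pair_in x y f ＆ (y ∈ x));

  ax_ACLA :
    truth ((∃ A : M, ∼ (A^! ⊆ A^?)) ∧ (∃ A : M, ∼ (A^? ⊆ A^!)))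
}.

(* Main.v *)
(* A counting can be followed by the inverse of another one, so each of the four
   relations between [A] and [B] amounts to the existence or
   non-existence of a partial injection [H] between the realms that respects
   suitable parts; elements left unmatched are counted by fresh values.

   What remains is to assemble such an [H] from the injections between the parts,
   and this needs neither Choice nor cardinal arithmetic.  Let [K : Q -> V] and
   [H : P -> U] be injections with [P ⊆ Q], [U ⊆ V].  Call [x] in [P] a source if
   [K x] is not in [U], and switch from [K] to [H] along each alternating path
   [H x = K x'] that starts from a source.  If the path ends in [Q \ P], its end
   takes the abandoned value [K s] of the source [s].  The result is an injection
   of [Q] into [V] that maps [P] into [U] and disturbs [Q \ P] only by values
   outside of [U].
   - For [A ⪯ B], this first makes each given injection send [A_t] into [B_t].
     The injection of [rlm A] is then corrected on [A^!], and after that on [A^?];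
     the second correction moves elements outside of [A^?] only to values outside
     of [B^?], hence in [B^!], so that it preserves the first one.
   - For [A ≇ B], it turns [A^! ⪯ B^?] and [A_b ⪯ B_n] into one injection of
     [A^!] into [B^?] that maps [A_b] into [B_n], and likewise with [A] and [B]
     exchanged; the two are merged as in the Cantor–Bernstein theorem. *)

From Stdlib Require Import Classical PropExtensionality
  FunctionalExtensionality List Lia PeanoNat.
Require Import Defs.
Import ListNotations.

(** The bridge between the four-valued object language and the metatheory: such a [t] has neither a
    gap nor a glut, so it can stand for the ordinary proposition [Q]. *)
Definition decides (t : tv) (Q : Prop) : Prop :=
  (truth t <-> Q) /\ (falsity t <-> ~ Q).

(** * Definability with parameters *)

Section Definability.
Context {M : model}.

(* Variable 0 and the odd variables carry the arguments of a definable
   predicate, so that 0 and 1 are the displayed variables of the axiom schemas;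
   the even variables from 2 on carry parameters, at an arbitrary offset [k], so
   that the parameters of two formulas can be kept apart. *)
Definition free_vars (rho : assignment M) : assignment M :=
  fun i => rho (2 * i - 1).

Definition stores (ps : list M) (k : nat) (rho : assignment M) : Prop :=
  forall j c, nth_error ps j = Some c -> rho (2 * (k + j) + 2) = c.

Definition term (s : assignment M -> M) : Prop :=
  exists ps, forall k, exists v, forall rho,
    stores ps k rho -> rho v = s (free_vars rho).

Definition definable (P : assignment M -> Prop) : Prop :=
  exists ps, forall k, exists phi, forall rho,
    stores ps k rho -> decides (eval rho phi) (P (free_vars rho)).

Lemma stores_app (ps qs : list M) k rho :
  stores (ps ++ qs) k rho ->
  stores ps k rho /\ stores qs (k + length ps) rho.
Proof.
  intros H; split; intros j c Hj.
  - apply H. rewrite nth_error_app1; [exact Hj|].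
    apply nth_error_Some. congruence.
  - rewrite <- Nat.add_assoc. apply H.
    rewrite nth_error_app2 by lia.
    replace (length ps + j - length ps) with j by lia. exact Hj.
Qed.

Lemma upd_same (rho : assignment M) i a : upd rho i a i = a.
Proof. unfold upd. now rewrite Nat.eqb_refl. Qed.

Lemma upd_other (rho : assignment M) i j a : j <> i -> upd rho i a j = rho j.
Proof. unfold upd. now intros H%Nat.eqb_neq; rewrite H. Qed.

(** By truncated subtraction [2 * i - 1] is 0 or odd, whereas parameters sit at even variables from
    2 on. *)
Lemma stores_upd ps k (rho : assignment M) i a :
  stores ps k rho -> stores ps k (upd rho (2 * i - 1) a).
Proof.
  intros H j c Hj. rewrite upd_other by lia. now apply H.
Qed.

Lemma free_vars_upd (rho : assignment M) n a :
  free_vars (upd rho (2 * n - 1) a) = upd (free_vars rho) n a.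
Proof.
  apply functional_extensionality; intros i. unfold free_vars, upd.
  destruct (Nat.eqb_spec i n) as [->|Hin].
  - now rewrite Nat.eqb_refl.
  - replace (2 * i - 1 =? 2 * n - 1) with false; [reflexivity|].
    symmetry; apply Nat.eqb_neq. lia.
Qed.

Lemma term_var i : term (fun e => e i).
Proof. exists []; intros k; now exists (2 * i - 1). Qed.

Lemma term_const c : term (fun _ => c).
Proof.
  exists [c]; intros k; exists (2 * (k + 0) + 2); intros rho H.
  now apply H.
Qed.

(** * Closure properties of definable predicates *)

Definition FBang (f : form) : form := FNot (FImp f FBot).

Lemma definable_atom (F : nat -> nat -> form) (C : M -> M -> Prop) s t :
  (forall rho i j, decides (eval rho (F i j)) (C (rho i) (rho j))) ->
  term s -> term t -> definable (fun e => C (s e) (t e)).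
Proof.
  intros HF [ps Hs] [qs Ht]. exists (ps ++ qs); intros k.
  destruct (Hs k) as [v Hv], (Ht (k + length ps)) as [w Hw].
  exists (F v w). intros rho [H1 H2]%stores_app.
  rewrite <- (Hv rho H1), <- (Hw rho H2). apply HF.
Qed.

Lemma definable_mem_pos s t :
  term s -> term t -> definable (fun e => mem_pos M (s e) (t e)).
Proof.
  apply (definable_atom (fun i j => FBang (FMem i j))).
  intros; unfold decides; cbn; tauto.
Qed.

(** [!∼(x ∈ A)] is true exactly when [x ∈ A] is false, so the falsity of membership has a two-valued
    definition as well. *)
Lemma definable_mem_neg s t :
  term s -> term t -> definable (fun e => mem_neg M (s e) (t e)).
Proof.
  apply (definable_atom (fun i j => FBang (FNot (FMem i j)))).
  intros; unfold decides; cbn; tauto.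
Qed.

Lemma definable_eq s t :
  term s -> term t -> definable (fun e => s e = t e).
Proof.
  apply (definable_atom (fun i j => FBang (FEq i j)) (fun x y => x = y)).
  intros; unfold decides; cbn; tauto.
Qed.

(** The premise concerns two-valued arguments only, and on these the connectives of BS4 act as the
    classical ones. *)
Lemma definable_connective (F : form -> form -> form)
    (C : Prop -> Prop -> Prop) P Q :
  (forall (rho : assignment M) f g p q,
     decides (eval rho f) p -> decides (eval rho g) q ->
     decides (eval rho (F f g)) (C p q)) ->
  definable P -> definable Q -> definable (fun e => C (P e) (Q e)).
Proof.
  intros HF [ps HP] [qs HQ]. exists (ps ++ qs); intros k.
  destruct (HP k) as [f Hf], (HQ (k + length ps)) as [g Hg].
  exists (F f g). intros rho [H1 H2]%stores_app. auto.
Qed.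

Lemma definable_and P Q :
  definable P -> definable Q -> definable (fun e => P e /\ Q e).
Proof.
  apply (definable_connective FAnd and).
  unfold decides; cbn; intros rho f g p q.
  destruct (classic p), (classic q); tauto.
Qed.

Lemma definable_or P Q :
  definable P -> definable Q -> definable (fun e => P e \/ Q e).
Proof.
  apply (definable_connective FOr or).
  unfold decides; cbn; intros rho f g p q.
  destruct (classic p), (classic q); tauto.
Qed.

Lemma definable_imp P Q :
  definable P -> definable Q -> definable (fun e => P e -> Q e).
Proof.
  apply (definable_connective FImp (fun p q => p -> q)).
  unfold decides; cbn; intros rho f g p q.
  destruct (classic p), (classic q); tauto.
Qed.

Lemma definable_iff P Q :
  definable P -> definable Q -> definable (fun e => P e <-> Q e).
Proof.
  apply (definable_connective FIff iff).
  unfold decides; cbn; intros rho f g p q.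
  destruct (classic p), (classic q); tauto.
Qed.

Lemma definable_false : definable (fun _ => False).
Proof.
  exists []; intros k; exists FBot; unfold decides; cbn; tauto.
Qed.

Lemma definable_true : definable (fun _ => True).
Proof.
  exists []; intros k; exists (FNot FBot); unfold decides; cbn; tauto.
Qed.

Lemma definable_not P : definable P -> definable (fun e => ~ P e).
Proof. intros HP. exact (definable_imp _ _ HP definable_false). Qed.

Lemma decides_all (f : M -> tv) (Q : M -> Prop) :
  (forall a, decides (f a) (Q a)) -> decides (tall f) (forall a, Q a).
Proof.
  intros H; split; cbn.
  - split; intros G a; apply (H a), G.
  - split.
    + intros [a Ha] G. exact (proj1 (proj2 (H a)) Ha (G a)).
    + intros [a Ha]%not_all_ex_not. exists a. now apply (proj2 (H a)).
Qed.

Lemma decides_ex (f : M -> tv) (Q : M -> Prop) :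
  (forall a, decides (f a) (Q a)) -> decides (tex f) (exists a, Q a).
Proof.
  intros H; split; cbn.
  - split; intros [a G]; exists a; apply (H a), G.
  - split.
    + intros G [a Ha]. exact (proj1 (proj2 (H a)) (G a) Ha).
    + intros G a. apply (proj2 (H a)). intros Ha; apply G. now exists a.
Qed.

(** The second premise says that [P] does not look at variable [n], so that [n] may serve as the
    bound variable. *)
Lemma definable_all n (P : assignment M -> M -> Prop) :
  definable (fun e => P e (e n)) ->
  (forall e a b, P (upd e n a) b <-> P e b) ->
  definable (fun e => forall x, P e x).
Proof.
  intros [ps HP] Hn. exists ps; intros k.
  destruct (HP k) as [phi Hphi]. exists (FAll (2 * n - 1) phi).
  intros rho Hrho. apply decides_all. intros a.
  specialize (Hphi _ (stores_upd _ _ _ n a Hrho)).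
  rewrite free_vars_upd, upd_same in Hphi.
  unfold decides in *. now rewrite <- (Hn _ a).
Qed.

Lemma definable_ex n (P : assignment M -> M -> Prop) :
  definable (fun e => P e (e n)) ->
  (forall e a b, P (upd e n a) b <-> P e b) ->
  definable (fun e => exists x, P e x).
Proof.
  intros [ps HP] Hn. exists ps; intros k.
  destruct (HP k) as [phi Hphi]. exists (FEx (2 * n - 1) phi).
  intros rho Hrho. apply decides_ex. intros a.
  specialize (Hphi _ (stores_upd _ _ _ n a Hrho)).
  rewrite free_vars_upd, upd_same in Hphi.
  unfold decides in *. now rewrite <- (Hn _ a).
Qed.

(** An explicit substitution of [v] for [u], which avoids renaming inside [phi]. *)
Definition FLet (u v : nat) (phi : form) : form :=
  FEx u (FAnd (FBang (FEq u v)) phi).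

Lemma decides_let (rho : assignment M) u v phi Q :
  u <> v -> decides (eval (upd rho u (rho v)) phi) Q ->
  decides (eval rho (FLet u v phi)) Q.
Proof.
  intros Huv [H1 H2]; split; cbn.
  - rewrite <- H1. split.
    + intros [a [[Ha _] G]]. rewrite upd_same, upd_other in Ha by congruence.
      now subst a.
    + intros G. exists (rho v). now rewrite upd_same, upd_other by congruence.
  - rewrite <- H2. split.
    + intros G. destruct (G (rho v)) as [E|E]; [|exact E].
      now rewrite upd_same, upd_other in E by congruence.
    + intros G a. rewrite upd_same, upd_other by congruence.
      destruct (classic (a = rho v)) as [->|Ha]; auto.
Qed.

Definition definable1 (X : M -> Prop) : Prop := definable (fun e => X (e 0)).
Definition definable2 (H : M -> M -> Prop) : Prop :=
  definable (fun e => H (e 0) (e 1)).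

(* The detour through two fresh variables makes the simultaneous substitution
   capture-free. *)
Lemma definable_subst2 (H : M -> M -> Prop) s t :
  definable2 H -> term s -> term t -> definable (fun e => H (s e) (t e)).
Proof.
  intros [ps HH] [qs Hs] [rs Ht]. exists (ps ++ qs ++ rs); intros k.
  destruct (HH k) as [phi Hphi], (Hs (k + length ps)) as [v Hv],
    (Ht (k + length ps + length qs)) as [w Hw].
  (* Both variables are odd and larger than [v], [w] and 1, so they collide neither with the
     arguments nor with a parameter. *)
  set (x := 2 * (v + w + 2) - 1). set (y := 2 * (v + w + 3) - 1).
  exists (FLet x v (FLet y w (FLet (2 * 0 - 1) x (FLet (2 * 1 - 1) y phi)))).
  intros rho [H1 [H2 H3]%stores_app]%stores_app.
  apply decides_let; [unfold x; lia|]. apply decides_let; [unfold y; lia|].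
  apply decides_let; [unfold x; lia|]. apply decides_let; [unfold y; lia|].
  set (rho1 := upd rho x _). set (rho2 := upd rho1 y _).
  set (rho3 := upd rho2 _ _). set (rho4 := upd rho3 _ _).
  assert (H4 : stores ps k rho4) by now repeat apply stores_upd.
  specialize (Hphi _ H4). unfold free_vars at 1 2 in Hphi.
  replace (rho4 (2 * 0 - 1)) with (s (free_vars rho)) in Hphi.
  - replace (rho4 (2 * 1 - 1)) with (t (free_vars rho)) in Hphi;
      [exact Hphi|].
    unfold rho4. rewrite upd_same. unfold rho3.
    rewrite upd_other by (unfold y; lia).
    unfold rho2. rewrite upd_same. unfold rho1.
    rewrite upd_other by (unfold x; lia). symmetry; now apply Hw.
  - unfold rho4. rewrite upd_other by lia. unfold rho3. rewrite upd_same.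
    unfold rho2. rewrite upd_other by (unfold x, y; lia). unfold rho1.
    rewrite upd_same. symmetry; now apply Hv.
Qed.

Lemma definable_subst1 (X : M -> Prop) s :
  definable1 X -> term s -> definable (fun e => X (s e)).
Proof.
  intros HX Hs. exact (definable_subst2 (fun x _ => X x) s s HX Hs Hs).
Qed.

(** Inverts the placement of parameters at offset 0. All other values are arbitrary: the displayed
    variables of an axiom schema are overwritten by [upd]. *)
Definition assign_params (ps : list M) (d : M) : assignment M :=
  fun v => nth (Nat.div2 (v - 2)) ps d.

Lemma stores_assign_params ps d : stores ps 0 (assign_params ps d).
Proof.
  intros j c Hj. unfold assign_params.
  replace (2 * (0 + j) + 2 - 2) with (2 * j) by lia.
  rewrite Nat.div2_double. now apply nth_error_nth.
Qed.

End Definability.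

Ltac definability n :=
  cbv beta;
  lazymatch goal with
  | |- term _ => first [exact (term_var _) | exact (term_const _)]
  | |- definable (fun e => True) => exact definable_true
  | |- definable (fun e => False) => exact definable_false
  | |- definable (fun e => @?P e /\ @?Q e) =>
      apply (definable_and P Q); definability n
  | |- definable (fun e => @?P e \/ @?Q e) =>
      apply (definable_or P Q); definability n
  | |- definable (fun e => @?P e <-> @?Q e) =>
      apply (definable_iff P Q); definability n
  | |- definable (fun e => ~ @?P e) =>
      apply (definable_not P); definability n
  | |- definable (fun e => exists x, @?P e x) =>
      apply (definable_ex n P);
      [let m := eval cbv in (S n) in definability m | intros; apply iff_refl]
  | |- definable (fun e => mem_pos _ _ _) =>
      apply definable_mem_pos; definability n
  | |- definable (fun e => mem_neg _ _ _) =>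
      apply definable_mem_neg; definability n
  | |- definable (fun e => _ = _) => apply definable_eq; definability n
  | |- definable (fun e => forall x : carrier _, @?P e x) =>
      apply (definable_all n P);
      [let m := eval cbv in (S n) in definability m | intros; apply iff_refl]
  | |- definable (fun e => @?P e -> @?Q e) =>
      apply (definable_imp P Q); definability n
  | |- _ =>
      match goal with
      | |- definable (fun e => ?H (@?s e) (@?t e)) =>
          apply (definable_subst2 H s t); [solve [auto with definable]|..];
          definability n
      | |- definable (fun e => ?X (@?s e)) =>
          apply (definable_subst1 X s); [solve [auto with definable]|..];
          definability n
      end
  end.
Create HintDb definable.

(** * Sets of a model of BZFC *)

Section Sets.
Context {M : model} (HM : BZFC M).

(** The representing [c] is a classical set, since its membership is false exactly where [X]
    fails. *)
Definition isset (X : M -> Prop) : Prop :=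
  exists c : M, forall x, decides (memv x c) (X x).

Lemma isset_definable X : isset X -> definable1 X.
Proof.
  intros [c Hc].
  replace X with (fun x => mem_pos M x c).
  - unfold definable1. definability 1.
  - apply functional_extensionality; intros x.
    apply propositional_extensionality, Hc.
Qed.

Lemma isset_ext X Y : isset X -> (forall x, X x <-> Y x) -> isset Y.
Proof.
  intros [c Hc] H. exists c; intros x. unfold decides. rewrite <- H. apply Hc.
Qed.

Lemma set_ext (a b : M) :
  (forall x, mem_pos M x a <-> mem_pos M x b) ->
  (forall x, mem_neg M x a <-> mem_neg M x b) -> a = b.
Proof.
  intros H1 H2. apply (proj1 (ax_extensionality M HM a b)).
  intros x; split; cbn; auto.
Qed.

Lemma comprehension (P : M -> Prop) (A : M) :
  definable1 P ->
  exists B : M, forall x, (mem_pos M x B <-> mem_pos M x A /\ P x) /\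
                          (mem_neg M x B <-> mem_neg M x A \/ ~ P x).
Proof.
  intros [ps HP]. destruct (HP 0) as [phi Hphi].
  set (rho := assign_params ps A).
  destruct (ax_comprehension M HM phi rho A) as [B HB].
  exists B; intros x.
  specialize (Hphi _ (stores_upd ps 0 rho 0 x (stores_assign_params ps A))).
  destruct Hphi as [H1 H2], (HB x) as [H3 H4]. cbn in *.
  unfold free_vars in *. cbn in *. tauto.
Qed.

Lemma isset_sep X P : isset X -> definable1 P -> isset (fun x => X x /\ P x).
Proof.
  intros [c Hc] HP. destruct (comprehension P c HP) as [B HB].
  exists B; intros x. destruct (HB x) as [H1 H2], (Hc x) as [H3 H4].
  cbn in H3, H4. split; cbn; destruct (classic (P x)); tauto.
Qed.

Lemma replacement (P : M -> M -> Prop) (A : M) :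
  definable2 P ->
  (forall x, truth (rlm A x) -> exists y, forall z, P x z <-> z = y) ->
  exists B : M, forall y,
    (mem_pos M y B <-> exists x, P x y /\ mem_pos M x A) /\
    (mem_neg M y B <-> forall x, P x y -> mem_neg M x A).
Proof.
  intros [ps HP] HF. destruct (HP 0) as [phi Hphi].
  set (rho := assign_params ps A).
  assert (H : forall x y,
    decides (eval (upd (upd rho 0 x) 1 y) phi) (P x y)).
  { intros x y.
    (* The displayed variables 0 and 1 are [2 * 0 - 1] and [2 * 1 - 1], hence argument cells. *)
    exact (Hphi _ (stores_upd ps 0 _ 1 y
             (stores_upd ps 0 rho 0 x (stores_assign_params ps A)))). }
  destruct (ax_replacement M HM phi rho A) as [B HB].
  - intros x Hx. destruct (HF x Hx) as [y Hy]. exists y; intros z.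
    cbn. rewrite <- Hy. apply H.
  - exists B; intros y. destruct (HB y) as [H1 H2]. cbn in H1, H2. split.
    + rewrite H1. now split; intros [x Hx]; exists x; split;
        try apply (H x y); apply Hx.
    + rewrite H2. now split; intros G x Hx; apply G; apply (H x y).
Qed.

Lemma classical_superset (A : M) :
  exists C, isset C /\ forall x, truth (rlm A x) -> C x.
Proof.
  destruct (ax_classical_superset M HM A) as [C [H1 H2]].
  exists (fun x => mem_pos M x C). split.
  - exists C; intros x. specialize (H1 x). unfold decides. cbn in *.
    destruct (classic (mem_neg M x C)); tauto.
  - intros x. specialize (H1 x); specialize (H2 x). cbn in *.
    destruct (classic (mem_neg M x C)); tauto.
Qed.

(** Separation from [A] itself would inherit its gaps and gluts, so [X] is cut out of a classical
    superset instead. *)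
Lemma isset_of_sub_rlm (A : M) X :
  definable1 X -> (forall x, X x -> truth (rlm A x)) -> isset X.
Proof.
  intros HX HA. destruct (classical_superset A) as [C [HC H]].
  eapply isset_ext; [exact (isset_sep C X HC HX)|].
  cbn. intros x; split; [tauto|auto].
Qed.

Lemma exists_pair (a b : M) :
  exists C : M, forall z, decides (memv z C) (z = a \/ z = b).
Proof.
  destruct (ax_pairing M HM a b) as [C HC]. exists C; intros z.
  destruct (HC z) as [H1 H2]. unfold decides; cbn in *. tauto.
Qed.

Lemma exists_union (A : M) :
  exists B : M, forall x,
    (mem_pos M x B <-> exists y, mem_pos M y A /\ mem_pos M x y) /\
    (mem_neg M x B <-> forall y, mem_neg M y A \/ mem_neg M x y).
Proof.
  destruct (ax_union M HM A) as [B HB]. exists B; intros x.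
  destruct (HB x) as [H1 H2]. now cbn in *.
Qed.

Lemma exists_binary_union (a b : M) :
  exists c : M, forall x,
    (mem_pos M x c <-> mem_pos M x a \/ mem_pos M x b) /\
    (mem_neg M x c <-> mem_neg M x a /\ mem_neg M x b).
Proof.
  destruct (exists_pair a b) as [p Hp], (exists_union p) as [c Hc].
  exists c; intros x. destruct (Hc x) as [-> ->]. split.
  - split.
    + intros [y [Hy Hx]]. apply (Hp y) in Hy as [->| ->]; auto.
    + intros [Hx|Hx]; [exists a|exists b]; split; auto; apply Hp; auto.
  - split.
    + intros G. split; [destruct (G a) as [E|E]|destruct (G b) as [E|E]];
        auto; apply Hp in E; tauto.
    + intros [Ha Hb] y. destruct (classic (y = a \/ y = b)) as [[->| ->]|E];
        auto. left; now apply Hp.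
Qed.

(** * Singletons and ordered pairs *)

Definition is_sing (x z : M) : Prop := truth (z ≐ sing x).
Definition is_sing' (x z : M) : Prop := truth (z ≐ sing' x).
Definition is_opair (a b p : M) : Prop := truth (p ≐ opair a b).

(** Class terms are not elements of the model; this makes the relations [is_sing], [is_sing'] and
    [is_opair] functional in their last argument. *)
Lemma ceq_functional (A : class M) (z w : M) :
  truth (z ≐ A) -> truth (w ≐ A) -> z = w.
Proof.
  intros Hz Hw. apply set_ext; intros x;
    specialize (Hz x); specialize (Hw x); cbn in *; tauto.
Qed.

Lemma ceq_decides (A : class M) (Q : M -> Prop) (z : M) :
  (forall y, decides (A y) (Q y)) ->
  truth (z ≐ A) <-> forall y, decides (memv y z) (Q y).
Proof.
  intros HA. unfold decides; cbn.
  split; intros H y; specialize (H y); destruct (HA y); cbn in *; tauto.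
Qed.

Lemma is_sing_spec x z :
  is_sing x z <-> forall y, decides (memv y z) (y = x).
Proof. apply ceq_decides. intros y; split; cbn; tauto. Qed.

Lemma is_sing'_spec x z :
  is_sing' x z <->
  forall y, decides (memv y z) (truth (y ≐ empty) \/ is_sing x y).
Proof. apply ceq_decides. intros y; split; cbn -[ceq]; tauto. Qed.

Lemma exists_sing x : exists z, is_sing x z.
Proof.
  destruct (exists_pair x x) as [z Hz]. exists z. apply is_sing_spec.
  intros y. specialize (Hz y). unfold decides in *. tauto.
Qed.

Lemma exists_empty : exists z : M, truth (z ≐ empty).
Proof.
  destruct (carrier_inh M) as [a].
  destruct (comprehension (fun _ => False) a definable_false) as [z Hz].
  exists z; intros x. specialize (Hz x). cbn. tauto.
Qed.

Lemma exists_sing' x : exists z, is_sing' x z.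
Proof.
  destruct (exists_sing x) as [s Hs], exists_empty as [e He].
  destruct (exists_pair e s) as [z Hz]. exists z. apply is_sing'_spec.
  intros y.
  assert (truth (y ≐ empty) \/ is_sing x y <-> y = e \/ y = s) as E.
  { split.
    - intros [H|H]; [left|right]; eapply ceq_functional; eassumption.
    - intros [->| ->]; auto. }
  unfold decides in *. rewrite E. apply Hz.
Qed.

Lemma is_sing_inj x y z : is_sing x z -> is_sing y z -> x = y.
Proof.
  rewrite !is_sing_spec. intros H1 H2. apply (H2 x), (H1 x). reflexivity.
Qed.

Lemma sing_not_empty x z : is_sing x z -> ~ truth (z ≐ empty).
Proof.
  rewrite is_sing_spec. intros H1 H2.
  specialize (H2 x). cbn in H2. now apply H2, (H1 x).
Qed.

Lemma is_sing'_inj x y z : is_sing' x z -> is_sing' y z -> x = y.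
Proof.
  rewrite !is_sing'_spec. intros H1 H2.
  destruct (exists_sing x) as [s Hs].
  assert (Hz : mem_pos M s z) by (apply (H1 s); auto).
  apply (H2 s) in Hz as [He|Hy].
  - now apply (sing_not_empty _ _ Hs) in He.
  - exact (is_sing_inj _ _ _ Hs Hy).
Qed.

(** [{∅,{y}}] has two elements because [{y}] is not empty, while [{x}] has only one. *)
Lemma is_sing_sing' x y z : is_sing x z -> is_sing' y z -> False.
Proof.
  rewrite is_sing_spec, is_sing'_spec. intros H1 H2.
  destruct (exists_sing y) as [s Hs], exists_empty as [e He].
  assert (E1 : mem_pos M s z) by (apply (H2 s); auto).
  assert (E2 : mem_pos M e z) by (apply (H2 e); auto).
  apply (H1 s) in E1. apply (H1 e) in E2. subst s e.
  exact (sing_not_empty _ _ Hs He).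
Qed.

Lemma definable_is_sing : definable2 is_sing.
Proof. unfold definable2, is_sing; cbn. definability 2. Qed.

Lemma definable_is_sing' : definable2 is_sing'.
Proof. unfold definable2, is_sing'; cbn. definability 2. Qed.

Lemma exists_image (T : M -> M -> Prop) (a : M) :
  definable2 T -> (forall x, exists z, T x z) ->
  (forall x z w, T x z -> T x w -> z = w) ->
  exists b : M, forall z,
    (mem_pos M z b <-> exists x, T x z /\ mem_pos M x a) /\
    (mem_neg M z b <-> forall x, T x z -> mem_neg M x a).
Proof.
  intros HT Hex Hfun. apply replacement; [exact HT|].
  intros x _. destruct (Hex x) as [z Hz]. exists z; intros w.
  split; [intros Hw; exact (Hfun _ _ _ Hw Hz)|now intros ->].
Qed.

Lemma exists_opair a b : exists p, is_opair a b p.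
Proof.
  destruct (exists_image is_sing a) as [u Hu].
  { exact definable_is_sing. } { exact exists_sing. }
  { intros x z w. apply ceq_functional. }
  destruct (exists_image is_sing' b) as [v Hv].
  { exact definable_is_sing'. } { exact exists_sing'. }
  { intros x z w. apply ceq_functional. }
  destruct (exists_binary_union u v) as [p Hp]. exists p; intros z.
  destruct (Hp z) as [P1 P2], (Hu z) as [U1 U2], (Hv z) as [V1 V2].
  (* The falsity of [p ＆ q] says that the truth of [p] implies the falsity of [q], so only the truth
     of [z ≐ sing x] and [z ≐ sing' x] matters on either side. *)
  change (((mem_pos M z p <-> exists x, is_sing x z /\ mem_pos M x a \/
                                      is_sing' x z /\ mem_pos M x b)) /\
          ((mem_neg M z p <-> forall x, (is_sing x z -> mem_neg M x a) /\
                                      (is_sing' x z -> mem_neg M x b)))).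
  rewrite P1, P2, U1, U2, V1, V2. split; split.
  - intros [[x H]|[x H]]; exists x; auto.
  - intros [x [H|H]]; [left|right]; exists x; exact H.
  - intros [G1 G2] x; auto.
  - intros G; split; intros x; apply (G x).
Qed.

Lemma is_opair_mem a b p z :
  is_opair a b p ->
  (mem_pos M z p <-> exists x, is_sing x z /\ mem_pos M x a \/
                               is_sing' x z /\ mem_pos M x b) /\
  (mem_neg M z p <-> forall x, (is_sing x z -> mem_neg M x a) /\
                               (is_sing' x z -> mem_neg M x b)).
Proof. intros Hp. exact (Hp z). Qed.

(** The tags [{x}] and [{∅,{x}}] are injective in [x] and never coincide, so the pair at the tag
    [{x}] records exactly the status of [x] in the first component. *)
Lemma opair_sing a b p x z :
  is_opair a b p -> is_sing x z ->
  (mem_pos M z p <-> mem_pos M x a) /\ (mem_neg M z p <-> mem_neg M x a).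
Proof.
  intros Hp Hx. destruct (is_opair_mem a b p z Hp) as [-> ->]. split; split.
  - intros [y [[Hy Ha]|[Hy _]]].
    + now rewrite (is_sing_inj _ _ _ Hx Hy).
    + destruct (is_sing_sing' _ _ _ Hx Hy).
  - intros Ha. exists x; auto.
  - intros G. now apply G.
  - intros Ha y; split; intros Hy.
    + now rewrite <- (is_sing_inj _ _ _ Hx Hy).
    + destruct (is_sing_sing' _ _ _ Hx Hy).
Qed.

Lemma opair_sing' a b p x z :
  is_opair a b p -> is_sing' x z ->
  (mem_pos M z p <-> mem_pos M x b) /\ (mem_neg M z p <-> mem_neg M x b).
Proof.
  intros Hp Hx. destruct (is_opair_mem a b p z Hp) as [-> ->]. split; split.
  - intros [y [[Hy _]|[Hy Hb]]].
    + destruct (is_sing_sing' _ _ _ Hy Hx).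
    + now rewrite (is_sing'_inj _ _ _ Hx Hy).
  - intros Ha. exists x; auto.
  - intros G. now apply G.
  - intros Ha y; split; intros Hy.
    + destruct (is_sing_sing' _ _ _ Hy Hx).
    + now rewrite <- (is_sing'_inj _ _ _ Hx Hy).
Qed.

Lemma is_opair_inj a b c d p :
  is_opair a b p -> is_opair c d p -> a = c /\ b = d.
Proof.
  intros H1 H2; split; apply set_ext; intros x.
  all: destruct (exists_sing x) as [s Hs], (exists_sing' x) as [t Ht].
  all: destruct (opair_sing _ _ _ _ _ H1 Hs), (opair_sing _ _ _ _ _ H2 Hs).
  all: destruct (opair_sing' _ _ _ _ _ H1 Ht), (opair_sing' _ _ _ _ _ H2 Ht).
  all: tauto.
Qed.

(** * Injections that are sets of the model *)

Lemma definable_pair_in (f : M) :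
  definable2 (fun x y => truth (pair_in x y f)).
Proof. unfold definable2; cbn. definability 2. Qed.

(* The injections that are sets of the model, seen as metatheoretic relations;
   they need not be total. *)
Definition internal_injection (H : M -> M -> Prop) : Prop :=
  exists f : M, truth (is_injection f) /\
    forall x y, truth (pair_in x y f) <-> H x y.

Lemma internal_injection_definable H : internal_injection H -> definable2 H.
Proof.
  intros [f [_ Hf]].
  replace H with (fun x y => truth (pair_in x y f)).
  - apply definable_pair_in.
  - apply functional_extensionality; intros x.
    apply functional_extensionality; intros y.
    apply propositional_extensionality, Hf.
Qed.

Lemma internal_injection_functional H x y z :
  internal_injection H -> H x y -> H x z -> y = z.
Proof.
  intros [f [[[_ [_ Hfun]] _] Hf]] H1%Hf H2%Hf.
  now apply (Hfun x y z).
Qed.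

Lemma internal_injection_injective H x y z :
  internal_injection H -> H x z -> H y z -> x = y.
Proof.
  intros [f [[_ Hinj] Hf]] H1%Hf H2%Hf.
  now apply (Hinj x y z).
Qed.

(** The injections constructed below enter the model here: Replacement turns the domain of [H] into
    the set of pairs [(x, H x)]. *)
Lemma internal_injection_intro X H :
  isset X -> definable2 H -> (forall x y, H x y -> X x) ->
  (forall x y z, H x y -> H x z -> y = z) ->
  (forall x y z, H x z -> H y z -> x = y) ->
  internal_injection H.
Proof.
  intros HX HH Hdom Hfun Hinj.
  (* Replacement asks for a value at every argument, so [X] is first cut down to the domain of
     [H]. *)
  assert (HD : isset (fun x => X x /\ exists y, H x y)).
  { apply isset_sep; [exact HX|]. unfold definable1. definability 1. }
  destruct HD as [D HD].
  set (P := fun x p => exists y, H x y /\ is_opair x y p).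
  assert (HP : definable2 P).
  { unfold P, definable2, is_opair; cbn. definability 2. }
  destruct (replacement P D HP) as [f Hf].
  { intros x Hx.
    assert (X x /\ exists y, H x y) as [_ [y Hy]].
    { specialize (HD x). unfold decides in HD. cbn in *. tauto. }
    destruct (exists_opair x y) as [p Hp]. exists p; intros q. split.
    - intros [z [Hz Hq]]. rewrite (Hfun x z y Hz Hy) in Hq.
      exact (ceq_functional _ _ _ Hq Hp).
    - intros ->. now exists y. }
  assert (Hpair : forall x y, truth (pair_in x y f) <-> H x y).
  { intros x y. split.
    - intros [p [Hp Hpf]]. apply (Hf p) in Hpf as [x' [[y' [Hxy Hp']] _]].
      now destruct (is_opair_inj _ _ _ _ _ Hp Hp') as [-> ->].
    - intros Hxy. destruct (exists_opair x y) as [p Hp]. exists p.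
      split; [exact Hp|]. apply (Hf p). exists x. split; [now exists y|].
      apply HD. split; [exact (Hdom x y Hxy)|now exists y]. }
  exists f; split; [|exact Hpair]. split; [split; [|split]|].
  - intros p. destruct (Hf p) as [H1 H2].
    (* [f] is classical because [D] is: Replacement carries truth and falsity over separately. *)
    assert (mem_neg M p f <-> ~ mem_pos M p f) as E.
    { rewrite H1, H2. split.
      - intros G [x [Hx HxD]]. apply HD in HxD as HxD'.
        exact (proj1 (proj2 (HD x)) (G x Hx) HxD').
      - intros G x Hx. apply HD. intros HxD. apply G. exists x.
        split; [exact Hx|now apply HD]. }
    cbn. rewrite E. destruct (classic (mem_pos M p f)); tauto.
  - intros p Hp. apply (Hf p) in Hp as [x [[y [_ Hp]] _]]. now exists x, y.
  - intros x y z [H1%Hpair H2%Hpair]. split; [exact (Hfun x y z H1 H2)|exact I].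
  - intros x y z [H1%Hpair H2%Hpair]. split; [exact (Hinj x y z H1 H2)|exact I].
Qed.

End Sets.

#[local] Hint Resolve isset_definable internal_injection_definable : definable.
(** * Exchange along alternating paths *)

Section Combinatorics.
Context {M : model} (HM : BZFC M).

Definition total_on (X : M -> Prop) (H : M -> M -> Prop) : Prop :=
  forall x, X x <-> exists y, H x y.

Section Exchange.
Context (A P U : M -> Prop) (K H : M -> M -> Prop).
Context (HA : isset A) (HP : isset P) (HU : isset U).
Context (HK : internal_injection K) (HKA : total_on A K).
Context (HH : internal_injection H) (HHP : total_on P H).
Context (HPA : forall x, P x -> A x) (HHU : forall x y, H x y -> U y).

(* [step] moves from [x] to the element whose [K]-value is [H x]: if [x] is
   switched from [K] to [H], then that element loses its place. *)
Let step (x y : M) : Prop := exists z, H x z /\ K y z.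

(** The closure under [step] is expressed by quantifying over the sets of the model, since an
    inductive predicate of the metatheory would not be definable. *)
Let reach (x y : M) : Prop :=
  forall Z : M, mem_pos M x Z ->
    (forall a b, mem_pos M a Z -> step a b -> mem_pos M b Z) -> mem_pos M y Z.

Let source (x : M) : Prop := P x /\ exists z, K x z /\ ~ U z.

Let moved (x : M) : Prop := exists s, source s /\ reach s x.

Lemma definable_step : definable2 step.
Proof. unfold definable2, step. definability 2. Qed.

Lemma definable_reach : definable2 reach.
Proof.
  pose proof definable_step. unfold definable2, reach. definability 2.
Qed.

Lemma definable_source : definable1 source.
Proof. unfold definable1, source. definability 1. Qed.

Lemma definable_moved : definable1 moved.
Proof.
  pose proof definable_reach. pose proof definable_source.
  unfold definable1, moved. definability 1.
Qed.

Lemma reach_refl x : reach x x.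
Proof. intros Z Hx _. exact Hx. Qed.

Lemma reach_step x y z : reach x y -> step y z -> reach x z.
Proof. intros Hxy Hyz Z Hx HZ. exact (HZ y z (Hxy Z Hx HZ) Hyz). Qed.

Lemma step_domain x y : step x y -> P x /\ A y.
Proof.
  intros [z [Hx Hy]]. split; [apply HHP|apply HKA]; now exists z.
Qed.

(** Induction needs a set to which [reach] can be applied, so [Q] has to be definable and the set is
    separated from [A], which steps never leave. Including [reach x a] in that set supplies the
    first premise of the step case. *)
Lemma reach_ind (Q : M -> Prop) x y :
  definable1 Q -> A x -> Q x ->
  (forall a b, reach x a -> Q a -> step a b -> Q b) ->
  reach x y -> A y /\ Q y.
Proof.
  intros HQ HAx HQx HQstep Hxy.
  assert (HZ : isset (fun a => A a /\ (reach x a /\ Q a))).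
  { apply (isset_sep HM); [exact HA|]. pose proof definable_reach.
    unfold definable1. definability 1. }
  destruct HZ as [Z HZ].
  assert (mem_pos M y Z) as Hy.
  { apply Hxy.
    - apply HZ. split; [exact HAx|]. split; [apply reach_refl|exact HQx].
    - intros a b Ha Hab. apply HZ in Ha as [_ [Hxa Ha]]. apply HZ.
      split; [exact (proj2 (step_domain a b Hab))|].
      split; [exact (reach_step x a b Hxa Hab)|exact (HQstep a b Hxa Ha Hab)]. }
  apply HZ in Hy. tauto.
Qed.

Lemma reach_inv_last x y :
  A x -> reach x y -> y = x \/ exists b, reach x b /\ step b y.
Proof.
  intros HAx Hxy. pose proof definable_reach. pose proof definable_step.
  apply (reach_ind (fun y => y = x \/ exists b, reach x b /\ step b y) x y).
  - unfold definable1. definability 1.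
  - exact HAx.
  - now left.
  - intros a b Hxa _ Hab. right. now exists a.
  - exact Hxy.
Qed.

Lemma reach_inv_first x y :
  A x -> reach x y -> y = x \/ exists b, step x b /\ reach b y.
Proof.
  intros HAx Hxy. pose proof definable_reach. pose proof definable_step.
  apply (reach_ind (fun y => y = x \/ exists b, step x b /\ reach b y) x y).
  - unfold definable1. definability 1.
  - exact HAx.
  - now left.
  - intros a b _ [->|[c [Hxc Hca]]] Hab; right.
    + exists b. split; [exact Hab|apply reach_refl].
    + exists c. split; [exact Hxc|exact (reach_step c a b Hca Hab)].
  - exact Hxy.
Qed.

(** The [K]-value of a source lies outside of [U], while a predecessor [x] would make it the
    [H]-value of [x], which lies in [U]. *)
Lemma source_not_target s x : source s -> ~ step x s.
Proof.
  intros [_ [z [Hz HzU]]] [w [Hw Hsw]].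
  rewrite (internal_injection_functional K s z w HK Hz Hsw) in HzU.
  apply HzU. exact (HHU x w Hw).
Qed.

Lemma step_injective a b c : step a c -> step b c -> a = b.
Proof.
  intros [z [Ha Hc]] [w [Hb Hc']].
  rewrite (internal_injection_functional K c z w HK Hc Hc') in Ha.
  exact (internal_injection_injective H a b w HH Ha Hb).
Qed.

Lemma step_functional a b c : step a b -> step a c -> b = c.
Proof.
  intros [z [Ha Hb]] [w [Ha' Hc]].
  rewrite (internal_injection_functional H a z w HH Ha Ha') in Hb.
  exact (internal_injection_injective K b c w HK Hb Hc).
Qed.

Lemma source_domain s : source s -> A s.
Proof. intros [Hs _]. exact (HPA s Hs). Qed.

(** Steps are injective and none ends in a source, so [x] can be traced back in only one way. *)
Lemma reach_source_unique s t x :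
  source s -> source t -> reach s x -> reach t x -> s = t.
Proof.
  intros Hs Ht Hsx.
  pose proof definable_reach. pose proof definable_source.
  apply (reach_ind (fun x => reach t x -> s = t) s x).
  - unfold definable1. definability 1.
  - exact (source_domain s Hs).
  - intros Hts. destruct (reach_inv_last t s (source_domain t Ht) Hts)
      as [E|[b [_ Hb]]]; [exact E|].
    destruct (source_not_target s b Hs Hb).
  - intros a b _ IH Hab Htb.
    destruct (reach_inv_last t b (source_domain t Ht) Htb)
      as [->|[c [Hc Hcb]]].
    + destruct (source_not_target t a Ht Hab).
    + rewrite (step_injective c a b Hcb Hab) in Hc. exact (IH Hc).
  - exact Hsx.
Qed.

(** Steps are functional and start in [P], so a path is deterministic and stops at its first element
    outside of [P]. The induction keeps [y] reachable from the current element. *)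
Lemma reach_end_unique s x y :
  A s -> reach s x -> reach s y -> ~ P x -> ~ P y -> x = y.
Proof.
  intros Hs Hsx Hsy Hx Hy. pose proof definable_reach.
  destruct (reach_ind (fun x => reach x y) s x) as [HAx Hxy].
  - unfold definable1. definability 1.
  - exact Hs.
  - exact Hsy.
  - intros a b Hsa Hay Hab.
    assert (HPa := proj1 (step_domain a b Hab)).
    destruct (reach_inv_first a y (HPA a HPa) Hay) as [->|[c [Hac Hcy]]].
    + contradiction.
    + now rewrite (step_functional a b c Hab Hac).
  - exact Hsx.
  - destruct (reach_inv_first x y HAx Hxy) as [->|[b [Hxb _]]];
      [reflexivity|].
    destruct (Hx (proj1 (step_domain x b Hxb))).
Qed.

Lemma moved_domain x : moved x -> A x.
Proof.
  intros [s [Hs Hx]].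
  destruct (reach_ind (fun _ => True) s x) as [HAx _]; auto.
  - exact definable_true.
  - exact (source_domain s Hs).
Qed.

(* The last clause concerns the end of a finite path, which inherits the place
   vacated by the source; an infinite path has no end. *)
Let swap (x y : M) : Prop :=
  (moved x /\ H x y) \/ (~ moved x /\ K x y) \/
  (~ P x /\ exists s, source s /\ reach s x /\ K s y).

(** The last two clauses trace the new values back to [H] and [K]; they allow a second exchange to
    retain what a first one has achieved. *)
Lemma exchange :
  exists N, internal_injection N /\ total_on A N /\
    (forall x y, N x y -> P x -> U y) /\
    (forall x y, N x y -> P x -> H x y \/ K x y) /\
    (forall x y, N x y -> ~ P x ->
       K x y \/ (~ U y /\ exists s, K s y)).
Proof.
  pose proof definable_reach. pose proof definable_source.
  pose proof definable_moved.
  assert (HdomH : forall x y, H x y -> P x).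
  { intros x y Hxy. apply HHP. now exists y. }
  assert (HdomK : forall x y, K x y -> A x).
  { intros x y Hxy. apply HKA. now exists y. }
  assert (Hmoved : forall s, source s -> moved s).
  { intros s Hs. exists s. split; [exact Hs|apply reach_refl]. }
  (* Abandoned values lie outside of [U], so they cannot collide with values of [H]. *)
  assert (HsU : forall s y, source s -> K s y -> ~ U y).
  { intros s y [_ [z [Hz HzU]]] Hy.
    now rewrite <- (internal_injection_functional K s z y HK Hz Hy). }
  exists swap. split; [|split; [|split; [|split]]].
  - apply (internal_injection_intro HM A).
    + exact HA.
    + unfold definable2, swap. definability 2.
    + intros x y [[_ Hxy]|[[_ Hxy]|[_ [s [Hs [Hsx _]]]]]].
      * exact (HPA x (HdomH x y Hxy)).
      * exact (HdomK x y Hxy).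
      * apply moved_domain. now exists s.
    + intros x y z [[Hx Hxy]|[[Hx Hxy]|[Hx [s [Hs [Hsx Hsy]]]]]]
        [[Hx' Hxz]|[[Hx' Hxz]|[Hx' [t [Ht [Htx Htz]]]]]];
        try contradiction.
      * exact (internal_injection_functional H x y z HH Hxy Hxz).
      * destruct (Hx' (HdomH x y Hxy)).
      * exact (internal_injection_functional K x y z HK Hxy Hxz).
      * destruct Hx. now exists t.
      * destruct (Hx (HdomH x z Hxz)).
      * destruct Hx'. now exists s.
      * rewrite (reach_source_unique t s x Ht Hs Htx Hsx) in Htz.
        exact (internal_injection_functional K s y z HK Hsy Htz).
    (* An element whose [K]-value is taken over comes next on the path, so it is moved as well and
       has given up that value. *)
    + assert (HHK : forall x y z, moved x -> H x z -> K y z -> moved y).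
      { intros x y z [s [Hs Hsx]] Hxz Hyz. exists s. split; [exact Hs|].
        apply (reach_step s x y Hsx). now exists z. }
      intros x y z [[Hx Hxz]|[[Hx Hxz]|[Hx [s [Hs [Hsx Hsz]]]]]]
        [[Hy Hyz]|[[Hy Hyz]|[Hy [t [Ht [Hty Htz]]]]]].
      * exact (internal_injection_injective H x y z HH Hxz Hyz).
      * destruct (Hy (HHK x y z Hx Hxz Hyz)).
      * destruct (HsU t z Ht Htz (HHU x z Hxz)).
      * destruct (Hx (HHK y x z Hy Hyz Hxz)).
      * exact (internal_injection_injective K x y z HK Hxz Hyz).
      * rewrite (internal_injection_injective K x t z HK Hxz Htz) in Hx.
        destruct (Hx (Hmoved t Ht)).
      * destruct (HsU s z Hs Hsz (HHU y z Hyz)).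
      * rewrite (internal_injection_injective K y s z HK Hyz Hsz) in Hy.
        destruct (Hy (Hmoved s Hs)).
      * rewrite (internal_injection_injective K t s z HK Htz Hsz) in Hty.
        exact (reach_end_unique s x y (source_domain s Hs) Hsx Hty Hx Hy).
  - intros x. split.
    + intros Hx. destruct (classic (moved x)) as [Hm|Hm].
      * destruct (classic (P x)) as [HPx|HPx].
        { destruct (proj1 (HHP x) HPx) as [y Hy]. exists y. left; auto. }
        destruct Hm as [s [Hs Hsx]].
        destruct (proj1 (HKA s) (source_domain s Hs)) as [y Hy].
        exists y. right; right. split; [exact HPx|]. now exists s.
      * destruct (proj1 (HKA x) Hx) as [y Hy]. exists y. right; left; auto.
    + intros [y [[_ Hxy]|[[_ Hxy]|[_ [s [Hs [Hsx _]]]]]]].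
      * exact (HPA x (HdomH x y Hxy)).
      * exact (HdomK x y Hxy).
      * apply moved_domain. now exists s.
  - intros x y [[_ Hxy]|[[Hm Hxy]|[Hx _]]] HPx.
    + exact (HHU x y Hxy).
    (* An element of [P] with [K]-value outside of [U] is a source, hence moved. *)
    + apply NNPP. intros HyU. apply Hm, Hmoved. split; [exact HPx|].
      now exists y.
    + contradiction.
  - intros x y [[_ Hxy]|[[_ Hxy]|[Hx _]]] HPx; auto. contradiction.
  - intros x y [[_ Hxy]|[[_ Hxy]|[_ [s [Hs [_ Hsy]]]]]] HPx.
    + destruct (HPx (HdomH x y Hxy)).
    + now left.
    + right. split; [exact (HsU s y Hs Hsy)|now exists s].
Qed.

End Exchange.

(* Mendelsohn–Dulmage: [F] is used on the paths that start outside the range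
   of [G], and [G] elsewhere. *)
Lemma cover_both (D X Y : M -> Prop) (F G : M -> M -> Prop) :
  isset D -> isset X -> internal_injection F -> internal_injection G ->
  total_on X F -> total_on Y G -> (forall x, X x -> D x) ->
  (forall y x, G y x -> D x) ->
  exists H, internal_injection H /\
    (forall x y, H x y -> F x y \/ G y x) /\
    (forall x, X x -> exists y, H x y) /\ (forall y, Y y -> exists x, H x y).
Proof.
  intros HD HX HF HG HFX HGY HXD HGD.
  pose (base x := X x /\ ~ exists y, G y x).
  pose (step x x' := exists z, F x z /\ G z x' /\ X x').
  (* The elements of [X] on the paths from [base], again defined through the sets closed under
     [step]. *)
  pose (T x := forall Z : M,
    (forall a, base a -> mem_pos M a Z) ->
    (forall a b, mem_pos M a Z -> step a b -> mem_pos M b Z) ->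
    mem_pos M x Z).
  assert (Dbase : definable1 base).
  { unfold definable1, base. definability 1. }
  assert (Dstep : definable2 step).
  { unfold definable2, step. definability 2. }
  assert (DT : definable1 T). { unfold definable1, T. definability 1. }
  assert (Tbase : forall x, base x -> T x).
  { intros x Hx Z HZ _. exact (HZ x Hx). }
  assert (Tstep : forall x y, T x -> step x y -> T y).
  { intros x y Hx Hxy Z H1 H2. exact (H2 x y (Hx Z H1 H2) Hxy). }
  assert (Tinv : forall x, T x ->
    X x /\ (base x \/ exists y, T y /\ step y x)).
  { intros x Hx.
    assert (HZ : isset (fun x => X x /\
      (T x /\ (base x \/ exists y, T y /\ step y x)))).
    { apply (isset_sep HM); [exact HX|]. unfold definable1. definability 1. }
    destruct HZ as [Z HZ].
    assert (mem_pos M x Z) as HxZ; [|apply HZ in HxZ; tauto].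
    apply Hx.
    - intros a Ha. apply HZ. split; [apply Ha|]. auto.
    - intros a b Ha Hab. apply HZ in Ha as [_ [Ha _]]. apply HZ.
      split; [now destruct Hab as [z Hz]|].
      split; [exact (Tstep a b Ha Hab)|]. right. now exists a. }
  pose (N x y := (T x /\ F x y) \/ (G y x /\ ~ exists a, T a /\ F a y)).
  (* The two halves of [N] cannot disagree: if [x] in [T] is [G z], then [x] is not in [base], so it
     was reached by a step and [z] is [F a] for some [a] in [T]. *)
  assert (NGF : forall x y z, T x -> F x y -> G z x ->
    ~ (exists a, T a /\ F a z) -> False).
  { intros x y z Hx _ Hzx Hz.
    destruct (Tinv x Hx) as [_ [[_ Hb]|[a [Ha [w [Haw [Hwx _]]]]]]].
    - apply Hb. now exists z.
    - rewrite (internal_injection_injective G w z x HG Hwx Hzx) in Haw.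
      apply Hz. now exists a. }
  exists N. split; [|split; [|split]].
  - apply (internal_injection_intro HM D).
    + exact HD.
    + unfold definable2, N. definability 2.
    + intros x y [[Hx _]|[Hyx _]].
      * exact (HXD x (proj1 (Tinv x Hx))).
      * exact (HGD y x Hyx).
    + intros x y z [[Hx Hxy]|[Hyx Hy]] [[Hx' Hxz]|[Hzx Hz]].
      * exact (internal_injection_functional F x y z HF Hxy Hxz).
      * destruct (NGF x y z Hx Hxy Hzx Hz).
      * destruct (NGF x z y Hx' Hxz Hyx Hy).
      * exact (internal_injection_injective G y z x HG Hyx Hzx).
    + intros x y z [[Hx Hxz]|[Hzx Hz]] [[Hy Hyz]|[Hzy Hz']].
      * exact (internal_injection_injective F x y z HF Hxz Hyz).
      * destruct Hz'. now exists x.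
      * destruct Hz. now exists y.
      * exact (internal_injection_functional G z x y HG Hzx Hzy).
  - intros x y [[_ Hxy]|[Hyx _]]; auto.
  - intros x Hx. destruct (classic (T x)) as [HT|HT].
    + destruct (proj1 (HFX x) Hx) as [y Hy]. exists y. left; auto.
    + assert (exists y, G y x) as [y Hy].
      { apply NNPP. intros Hn. apply HT, Tbase. now split. }
      exists y. right. split; [exact Hy|]. intros [a [Ha Hay]].
      apply HT, (Tstep a x Ha). now exists y.
  - intros y Hy. destruct (classic (exists a, T a /\ F a y)) as [[a Ha]|Hn].
    + exists a. left; exact Ha.
    + destruct (proj1 (HGY y) Hy) as [x Hx]. exists x. right; auto.
Qed.

End Combinatorics.
(** * Countings and matchings *)

Section Matchings.
Context {M : model} (HM : BZFC M).
Implicit Types (A B : class M) (X Y : M -> Prop) (F G H : M -> M -> Prop).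

Definition pos A (x : M) : Prop := truth (A x).
Definition may A (x : M) : Prop := ~ falsity (A x).
Definition realm A (x : M) : Prop := pos A x \/ may A x.

(** Read classically, the contrapositive half of [⇒] becomes the inclusion of the non-false
    parts. *)
Lemma subset_true A B :
  truth (A ⊆ B) <->
  (forall z, pos A z -> pos B z) /\ (forall z, may A z -> may B z).
Proof.
  unfold pos, may; cbn; unfold cmem. split.
  - intros H; split; intros z; specialize (H z); tauto.
  - intros [H1 H2] z; specialize (H1 z); specialize (H2 z).
    destruct (classic (falsity (B z))); tauto.
Qed.

Lemma subset_false A B :
  falsity (A ⊆ B) <-> ~ forall z, pos A z -> may B z.
Proof.
  unfold pos, may; cbn; unfold cmem. split.
  - intros [z Hz] H; specialize (H z); tauto.
  - intros [z Hz]%not_all_ex_not. exists z. tauto.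
Qed.

Lemma ceq_true A B :
  truth (A ≐ B) <-> truth (A ⊆ B) /\ truth (B ⊆ A).
Proof.
  cbn. split; [intros H; split; intros z; specialize (H z); tauto|].
  intros [H1 H2] z; specialize (H1 z); specialize (H2 z); tauto.
Qed.

Lemma ceq_false A B :
  falsity (A ≐ B) <-> falsity (A ⊆ B) \/ falsity (B ⊆ A).
Proof.
  cbn. split.
  - intros [z Hz].
    assert (truth (z ∈ A) /\ falsity (z ∈ B) \/
            truth (z ∈ B) /\ falsity (z ∈ A)) as [E|E] by tauto;
      [left|right]; exists z; tauto.
  - intros [[z Hz]|[z Hz]]; exists z; tauto.
Qed.

(* [F[X] ⊆ G[Y]] *)
Definition image_sub F X G Y : Prop :=
  forall x z, F x z -> X x -> exists y, G y z /\ Y y.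

Lemma pos_image (f : M) A z :
  pos (image f A) z <-> exists x, truth (pair_in x z f) /\ pos A x.
Proof. reflexivity. Qed.

(** The falsity clause of [＆] looks only at the truth of [pair_in], so taking images commutes with
    passing to the non-false part. *)
Lemma may_image (f : M) A z :
  may (image f A) z <-> exists x, truth (pair_in x z f) /\ may A x.
Proof.
  change (~ (forall x, truth (pair_in x z f) -> falsity (A x)) <->
    exists x, truth (pair_in x z f) /\ may A x).
  unfold may. split.
  - intros [x Hx]%not_all_ex_not. exists x. tauto.
  - intros [x [Hx HA]] G. exact (HA (G x Hx)).
Qed.

Lemma image_subset_true (f g : M) A B :
  let F x y := truth (pair_in x y f) in
  let G x y := truth (pair_in x y g) in
  truth (image f A ⊆ image g B) <->
  image_sub F (pos A) G (pos B) /\ image_sub F (may A) G (may B).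
Proof.
  intros F G. rewrite subset_true. unfold image_sub. split.
  - intros [H1 H2]. split; intros x z Hx Ax.
    + apply pos_image, H1. now exists x.
    + apply may_image, H2, may_image. now exists x.
  - intros [H1 H2]. split; intros z.
    + intros [x [Hx Ax]]%pos_image. exact (H1 x z Hx Ax).
    + rewrite !may_image. intros [x [Hx Ax]]. exact (H2 x z Hx Ax).
Qed.

Lemma image_subset_false (f g : M) A B :
  let F x y := truth (pair_in x y f) in
  let G x y := truth (pair_in x y g) in
  falsity (image f A ⊆ image g B) <-> ~ image_sub F (pos A) G (may B).
Proof.
  intros F G. rewrite subset_false. unfold image_sub.
  apply not_iff_compat. split.
  - intros H x z Hx Ax. apply may_image, H. now exists x.
  - intros H z [x [Hx Ax]]%pos_image. apply may_image. exact (H x z Hx Ax).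
Qed.

(** * Countings *)

Definition counts A F : Prop :=
  internal_injection F /\ total_on (realm A) F.

Lemma decides_rlm A x : decides (rlm A x) (realm A x).
Proof. unfold decides, realm, pos, may; cbn; unfold cmem; tauto. Qed.

Lemma decides_dom (f x : M) :
  truth (classical f) -> decides (dom f x) (exists y, truth (pair_in x y f)).
Proof.
  intros Hf. apply decides_ex; intros y. apply decides_ex; intros p.
  specialize (Hf p). cbn -[ceq] in *. unfold decides. cbn -[ceq]. tauto.
Qed.

Lemma ceq_decided A B X Y :
  (forall x, decides (A x) (X x)) -> (forall x, decides (B x) (Y x)) ->
  truth (A ≐ B) <-> forall x, X x <-> Y x.
Proof.
  intros HA HB. cbn; unfold cmem.
  split; intros H x; specialize (H x); destruct (HA x), (HB x);
    destruct (classic (X x)), (classic (Y x)); tauto.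
Qed.

Lemma counting_spec A (f : M) :
  truth (counting A f) <->
  truth (is_injection f) /\
  total_on (realm A) (fun x y => truth (pair_in x y f)).
Proof.
  change (truth (is_injection f) /\ truth (dom f ≐ rlm A) <->
    truth (is_injection f) /\
    total_on (realm A) (fun x y => truth (pair_in x y f))).
  split; intros [Hf H]; split; try exact Hf.
  all: pose proof (ceq_decided (dom f) (rlm A) _ _
         (fun x => decides_dom f x (proj1 (proj1 Hf)))
         (decides_rlm A)) as E.
  - intros x. symmetry. exact (proj1 E H x).
  - apply E. intros x. symmetry. exact (H x).
Qed.

Lemma counting_counts A (f : M) :
  truth (counting A f) -> counts A (fun x y => truth (pair_in x y f)).
Proof.
  intros [Hf H]%counting_spec. split; [|exact H].
  now exists f.
Qed.

Lemma counts_counting A F :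
  counts A F ->
  exists f : M, truth (counting A f) /\ (fun x y => truth (pair_in x y f)) = F.
Proof.
  intros [[f [Hf HF]] H].
  assert ((fun x y => truth (pair_in x y f)) = F) as E.
  { apply functional_extensionality; intros x.
    apply functional_extensionality; intros y.
    apply propositional_extensionality, HF. }
  exists f. rewrite counting_spec, E. auto.
Qed.

(** * Partial matchings between realms *)

Definition forth H X Y : Prop := forall x, X x -> exists y, H x y /\ Y y.
Definition back H Y X : Prop := forall y, Y y -> exists x, H x y /\ X x.

(** Abstracts the composite of a counting of [A] with the inverse of a counting of [B], which is in
    general partial. *)
Definition matching A B H : Prop :=
  internal_injection H /\ forall x y, H x y -> realm A x /\ realm B y.

(** With [H] the inverse of [G] after [F], an inclusion of the image of [X] in that of [Y] provides
    each element of [X] with a partner in [Y]. *)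
Lemma matching_of_counts A B F G :
  isset (realm A) -> counts A F -> counts B G ->
  exists H, matching A B H /\
    (forall X Y, (forall x, X x -> realm A x) ->
       image_sub F X G Y -> forth H X Y) /\
    (forall X Y, (forall y, Y y -> realm B y) ->
       image_sub G Y F X -> back H Y X).
Proof.
  intros HA [HF HFA] [HG HGB].
  exists (fun x y => exists z, F x z /\ G y z).
  split; [split|split].
  - apply (internal_injection_intro HM (realm A)); auto.
    + unfold definable2. definability 2.
    + intros x y [z [Hz _]]. apply HFA. now exists z.
    + intros x y y' [z [Hx Hy]] [z' [Hx' Hy']].
      rewrite (internal_injection_functional F x z z' HF Hx Hx') in Hy.
      exact (internal_injection_injective G y y' z' HG Hy Hy').
    + intros x x' y [z [Hx Hy]] [z' [Hx' Hy']].
      rewrite (internal_injection_functional G y z z' HG Hy Hy') in Hx.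
      exact (internal_injection_injective F x x' z' HF Hx Hx').
  - intros x y [z [Hx Hy]]. split; [apply HFA|apply HGB]; now exists z.
  - intros X Y HX H x Hx. destruct (proj1 (HFA x) (HX x Hx)) as [z Hz].
    destruct (H x z Hz Hx) as [y [Hy HYy]]. exists y. split; [|exact HYy].
    now exists z.
  - intros X Y HY H y Hy. destruct (proj1 (HGB y) (HY y Hy)) as [z Hz].
    destruct (H y z Hz Hy) as [x [Hx HXx]]. exists x. split; [|exact HXx].
    now exists z.
Qed.

(* The partners of [H] are counted by [{y}]; the unmatched elements of [A]
   need a value outside of the range of the counting of [B], and get
   [{∅,{x}}]. *)
Lemma counts_of_matching A B H :
  isset (realm A) -> isset (realm B) -> matching A B H ->
  exists F G, counts A F /\ counts B G /\
    (forall X Y, forth H X Y -> image_sub F X G Y) /\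
    (forall X Y, back H Y X -> image_sub G Y F X).
Proof.
  intros HA HB [HH HHAB].
  pose proof (@definable_is_sing M). pose proof (@definable_is_sing' M).
  pose (F x z := (exists y, H x y /\ is_sing y z) \/
    (realm A x /\ ~ (exists y, H x y) /\ is_sing' x z)).
  pose (G y z := realm B y /\ is_sing y z).
  assert (HF : counts A F).
  { split.
    - apply (internal_injection_intro HM (realm A)); auto.
      + unfold definable2, F. definability 2.
      + intros x z [[y [Hxy _]]|[Hx _]]; [exact (proj1 (HHAB x y Hxy))|exact Hx].
      + intros x z w [[y [Hy Hz]]|[_ [Hn Hz]]] [[y' [Hy' Hw]]|[_ [Hn' Hw]]].
        * rewrite <- (internal_injection_functional H x y y' HH Hy Hy') in Hw.
          exact (ceq_functional HM _ _ _ Hz Hw).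
        * destruct Hn'. now exists y.
        * destruct Hn. now exists y'.
        * exact (ceq_functional HM _ _ _ Hz Hw).
      + intros x x' z [[y [Hy Hz]]|[_ [Hn Hz]]] [[y' [Hy' Hw]]|[_ [Hn' Hw]]].
        * rewrite <- (is_sing_inj y y' z Hz Hw) in Hy'.
          exact (internal_injection_injective H x x' y HH Hy Hy').
        * destruct (is_sing_sing' HM y x' z Hz Hw).
        * destruct (is_sing_sing' HM y' x z Hw Hz).
        * exact (is_sing'_inj HM x x' z Hz Hw).
    - intros x. split.
      + intros Hx. destruct (classic (exists y, H x y)) as [[y Hy]|Hn].
        * destruct (exists_sing HM y) as [z Hz]. exists z. left. now exists y.
        * destruct (exists_sing' HM x) as [z Hz]. exists z. right. auto.
      + intros [z [[y [Hxy _]]|[Hx _]]];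
          [exact (proj1 (HHAB x y Hxy))|exact Hx]. }
  assert (HG : counts B G).
  { split.
    - apply (internal_injection_intro HM (realm B)); auto.
      + unfold definable2, G. definability 2.
      + intros y z [Hy _]. exact Hy.
      + intros y z w [_ Hz] [_ Hw]. exact (ceq_functional HM _ _ _ Hz Hw).
      + intros y y' z [_ Hz] [_ Hw]. exact (is_sing_inj _ _ _ Hz Hw).
    - intros y. split.
      + intros Hy. destruct (exists_sing HM y) as [z Hz]. now exists z.
      + intros [z [Hy _]]. exact Hy. }
  assert (HFG : forall x y, H x y -> exists z, F x z /\ G y z).
  { intros x y Hxy. destruct (exists_sing HM y) as [z Hz]. exists z. split.
    - left. now exists y.
    - split; [exact (proj2 (HHAB x y Hxy))|exact Hz]. }
  exists F, G. split; [exact HF|split; [exact HG|split]].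
  - intros X Y HXY x z Hz Hx. destruct (HXY x Hx) as [y [Hxy Hy]].
    exists y. split; [|exact Hy]. destruct (HFG x y Hxy) as [w [Hw HG']].
    now rewrite (internal_injection_functional F x z w (proj1 HF) Hz Hw).
  - intros X Y HYX y z Hz Hy. destruct (HYX y Hy) as [x [Hxy Hx]].
    exists x. split; [|exact Hx]. destruct (HFG x y Hxy) as [w [HF' Hw]].
    now rewrite (internal_injection_functional G y z w (proj1 HG) Hz Hw).
Qed.

Lemma pos_realm A x : pos A x -> realm A x.
Proof. now left. Qed.

Lemma may_realm A x : may A x -> realm A x.
Proof. now right. Qed.

(** * Domination and equinumerosity in terms of matchings *)

Lemma dominated_true A B :
  isset (realm A) -> isset (realm B) ->
  truth (A ⪯ B) <->
  exists H, matching A B H /\ forth H (pos A) (pos B) /\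
    forth H (may A) (may B).
Proof.
  intros HA HB. split.
  - intros [f [Hf [g [Hg H]]]].
    apply image_subset_true in H as [H1 H2].
    apply counting_counts in Hf, Hg.
    destruct (matching_of_counts A B _ _ HA Hf Hg) as [N [HN [N1 _]]].
    exists N. auto using pos_realm, may_realm.
  - intros [N [HN [H1 H2]]].
    destruct (counts_of_matching A B N HA HB HN)
      as [F [G [HF [HG [FG _]]]]].
    destruct (counts_counting A F HF) as [f [Hf <-]].
    destruct (counts_counting B G HG) as [g [Hg <-]].
    exists f. split; [exact Hf|]. exists g. split; [exact Hg|].
    apply image_subset_true. auto.
Qed.

Lemma dominated_false A B :
  isset (realm A) -> isset (realm B) ->
  falsity (A ⪯ B) <->
  ~ exists H, matching A B H /\ forth H (pos A) (may B).
Proof.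
  intros HA HB.
  change (falsity (A ⪯ B)) with (forall f : M, truth (counting A f) ->
    forall g : M, truth (counting B g) -> falsity (image f A ⊆ image g B)).
  split.
  - intros Hn [N [HN H1]].
    destruct (counts_of_matching A B N HA HB HN)
      as [F [G [HF [HG [FG _]]]]].
    destruct (counts_counting A F HF) as [f [Hf <-]].
    destruct (counts_counting B G HG) as [g [Hg <-]].
    apply (proj1 (image_subset_false f g A B) (Hn f Hf g Hg)). auto.
  - intros Hn f Hf g Hg. apply image_subset_false. intros H. apply Hn.
    apply counting_counts in Hf, Hg.
    destruct (matching_of_counts A B _ _ HA Hf Hg) as [N [HN [N1 _]]].
    exists N. auto using pos_realm.
Qed.

Lemma equinumerous_true A B :
  isset (realm A) -> isset (realm B) ->
  truth (A ≅ B) <->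
  exists H, matching A B H /\
    (forth H (pos A) (pos B) /\ forth H (may A) (may B)) /\
    (back H (pos B) (pos A) /\ back H (may B) (may A)).
Proof.
  intros HA HB. split.
  - intros [f [Hf [g [Hg H]]]].
    apply ceq_true in H as [[H1 H2]%image_subset_true
                            [H3 H4]%image_subset_true].
    apply counting_counts in Hf, Hg.
    destruct (matching_of_counts A B _ _ HA Hf Hg) as [N [HN [N1 N2]]].
    exists N. auto 6 using pos_realm, may_realm.
  - intros [N [HN [[H1 H2] [H3 H4]]]].
    destruct (counts_of_matching A B N HA HB HN)
      as [F [G [HF [HG [FG GF]]]]].
    destruct (counts_counting A F HF) as [f [Hf <-]].
    destruct (counts_counting B G HG) as [g [Hg <-]].
    exists f. split; [exact Hf|]. exists g. split; [exact Hg|].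
    apply ceq_true. split; apply image_subset_true; auto.
Qed.

(** Falsity of [≐] is a disjunction of two false inclusions. Its failure for some pair of countings
    thus yields both conditions for one and the same matching. *)
Lemma equinumerous_false A B :
  isset (realm A) -> isset (realm B) ->
  falsity (A ≅ B) <->
  ~ exists H, matching A B H /\ forth H (pos A) (may B) /\
      back H (pos B) (may A).
Proof.
  intros HA HB.
  change (falsity (A ≅ B)) with (forall f : M, truth (counting A f) ->
    forall g : M, truth (counting B g) -> falsity (image f A ≐ image g B)).
  split.
  - intros Hn [N [HN [H1 H2]]].
    destruct (counts_of_matching A B N HA HB HN)
      as [F [G [HF [HG [FG GF]]]]].
    destruct (counts_counting A F HF) as [f [Hf <-]].
    destruct (counts_counting B G HG) as [g [Hg <-]].
    specialize (Hn f Hf g Hg). apply ceq_false in Hn as [Hn|Hn].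
    + apply (proj1 (image_subset_false f g A B) Hn). auto.
    + apply (proj1 (image_subset_false g f B A) Hn). auto.
  - intros Hn f Hf g Hg. apply ceq_false.
    rewrite !image_subset_false. apply not_and_or. intros [H1 H2]. apply Hn.
    apply counting_counts in Hf, Hg.
    destruct (matching_of_counts A B _ _ HA Hf Hg) as [N [HN [N1 N2]]].
    exists N. auto using pos_realm.
Qed.

(** * Injections and bijections between classical sets *)

Definition injects X Y : Prop :=
  exists H, internal_injection H /\ total_on X H /\ forall x y, H x y -> Y y.

Definition bijects X Y : Prop :=
  exists H, internal_injection H /\ total_on X H /\
    total_on Y (fun y x => H x y).

Lemma injects_of_forth H X Y :
  isset X -> internal_injection H -> forth H X Y -> injects X Y.
Proof.
  intros HX HH HXY. exists (fun x y => X x /\ H x y). split; [|split].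
  - apply (internal_injection_intro HM X); auto.
    + unfold definable2. definability 2.
    + tauto.
    + intros x y z [_ Hy] [_ Hz].
      exact (internal_injection_functional H x y z HH Hy Hz).
    + intros x y z [_ Hx] [_ Hy].
      exact (internal_injection_injective H x y z HH Hx Hy).
  - intros x. split; [|now intros [y [Hx _]]].
    intros Hx. destruct (HXY x Hx) as [y [Hy _]]. now exists y.
  - intros x y [Hx Hy]. destruct (HXY x Hx) as [z [Hz HYz]].
    now rewrite (internal_injection_functional H x y z HH Hy Hz).
Qed.

Lemma internal_injection_converse X H :
  isset X -> internal_injection H -> (forall x y, H x y -> X y) ->
  internal_injection (fun y x => H x y).
Proof.
  intros HX HH HHX. apply (internal_injection_intro HM X); auto.
  - unfold definable2. definability 2.
  - intros y x. apply HHX.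
  - intros z x y. exact (internal_injection_injective H x y z HH).
  - intros y z x. exact (internal_injection_functional H x y z HH).
Qed.

Lemma bijects_of_forth_back H X Y :
  isset X -> internal_injection H -> forth H X Y -> back H Y X -> bijects X Y.
Proof.
  intros HX HH HXY HYX.
  assert (HY : forall x y, X x -> H x y -> Y y).
  { intros x y Hx Hy. destruct (HXY x Hx) as [z [Hz HYz]].
    now rewrite (internal_injection_functional H x y z HH Hy Hz). }
  exists (fun x y => X x /\ H x y). split; [|split].
  - apply (internal_injection_intro HM X); auto.
    + unfold definable2. definability 2.
    + tauto.
    + intros x y z [_ Hy] [_ Hz].
      exact (internal_injection_functional H x y z HH Hy Hz).
    + intros x y z [_ Hx] [_ Hy].
      exact (internal_injection_injective H x y z HH Hx Hy).
  - intros x. split; [|now intros [y [Hx _]]].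
    intros Hx. destruct (HXY x Hx) as [y [Hy _]]. now exists y.
  - intros y. split.
    + intros Hy. destruct (HYX y Hy) as [x [Hxy Hx]]. now exists x.
    + intros [x [Hx Hxy]]. exact (HY x y Hx Hxy).
Qed.

(** Parts such as [A^!] are class terms and not elements of the model; a decided one behaves like a
    classical set. *)
Definition decided A X : Prop :=
  isset X /\ forall x, decides (A x) (X x).

Lemma decided_parts A X :
  decided A X -> pos A = X /\ may A = X /\ realm A = X.
Proof.
  intros [_ HX].
  assert (pos A = X) as E1.
  { apply functional_extensionality; intros x.
    apply propositional_extensionality. apply HX. }
  assert (may A = X) as E2.
  { apply functional_extensionality; intros x.
    apply propositional_extensionality. unfold may.
    rewrite (proj2 (HX x)). tauto. }
  split; [exact E1|split; [exact E2|]].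
  apply functional_extensionality; intros x.
  apply propositional_extensionality. unfold realm. rewrite E1, E2. tauto.
Qed.

Lemma decided_realm A X : decided A X -> isset (realm A).
Proof.
  intros HX. destruct (decided_parts A X HX) as [_ [_ ->]]. apply HX.
Qed.

Lemma matching_injects A B X Y :
  isset X ->
  (forall x, X x -> realm A x) -> (forall y, Y y -> realm B y) ->
  (exists H, matching A B H /\ forth H X Y) <-> injects X Y.
Proof.
  intros HX HXA HYB. split.
  - intros [H [[HH _] HXY]]. exact (injects_of_forth H X Y HX HH HXY).
  - intros [H [HH [HHX HHY]]]. exists H. split.
    + split; [exact HH|]. intros x y Hxy. split.
      * apply HXA, HHX. now exists y.
      * exact (HYB y (HHY x y Hxy)).
    + intros x Hx. destruct (proj1 (HHX x) Hx) as [y Hy].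
      exists y. split; [exact Hy|exact (HHY x y Hy)].
Qed.

(** For a decided class the true part, the non-false part and the realm coincide, so the two
    conditions on a matching collapse into one. *)
Lemma decided_dominated_true A B X Y :
  decided A X -> decided B Y -> truth (A ⪯ B) <-> injects X Y.
Proof.
  intros HA HB.
  pose proof (decided_realm A X HA) as SA.
  pose proof (decided_realm B Y HB) as SB.
  rewrite (dominated_true A B SA SB).
  rewrite <- (matching_injects A B X Y (proj1 HA)).
  - destruct (decided_parts A X HA) as [-> [-> _]].
    destruct (decided_parts B Y HB) as [-> [-> _]].
    split; intros [H HH]; exists H; tauto.
  - destruct (decided_parts A X HA) as [_ [_ ->]]; auto.
  - destruct (decided_parts B Y HB) as [_ [_ ->]]; auto.
Qed.

Lemma decided_dominated_false A B X Y :
  decided A X -> decided B Y -> falsity (A ⪯ B) <-> ~ injects X Y.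
Proof.
  intros HA HB.
  pose proof (decided_realm A X HA) as SA.
  pose proof (decided_realm B Y HB) as SB.
  rewrite (dominated_false A B SA SB).
  rewrite <- (matching_injects A B X Y (proj1 HA)).
  - destruct (decided_parts A X HA) as [-> _].
    now destruct (decided_parts B Y HB) as [_ [-> _]].
  - destruct (decided_parts A X HA) as [_ [_ ->]]; auto.
  - destruct (decided_parts B Y HB) as [_ [_ ->]]; auto.
Qed.

Lemma decided_equinumerous_true A B X Y :
  decided A X -> decided B Y -> truth (A ≅ B) <-> bijects X Y.
Proof.
  intros HA HB.
  rewrite (equinumerous_true A B (decided_realm A X HA) (decided_realm B Y HB)).
  unfold matching.
  destruct (decided_parts A X HA) as [-> [-> ->]].
  destruct (decided_parts B Y HB) as [-> [-> ->]].
  split.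
  - intros [H [[HH _] [[HXY _] [HYX _]]]].
    exact (bijects_of_forth_back H X Y (proj1 HA) HH HXY HYX).
  - intros [H [HH [HX HY]]]. exists H.
    assert (HHXY : forall x y, H x y -> X x /\ Y y).
    { intros x y Hxy. split; [apply HX; now exists y|apply HY; now exists x]. }
    assert (forth H X Y).
    { intros x Hx. destruct (proj1 (HX x) Hx) as [y Hy]. exists y.
      split; [exact Hy|exact (proj2 (HHXY x y Hy))]. }
    assert (back H Y X).
    { intros y Hy. destruct (proj1 (HY y) Hy) as [x Hx]. exists x.
      split; [exact Hx|exact (proj1 (HHXY x y Hx))]. }
    auto.
Qed.

(** * The parts of a set as classical sets *)

Section Parts.
Context (C : M).

Lemma isset_realm : isset (realm C).
Proof.
  apply (isset_of_sub_rlm HM C).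
  - unfold definable1, realm, pos, may; cbn. definability 1.
  - intros x. apply (decides_rlm C x).
Qed.

Lemma isset_pos : isset (pos C).
Proof.
  apply (isset_of_sub_rlm HM C).
  - unfold definable1, pos; cbn. definability 1.
  - intros x Hx. apply (decides_rlm C x). now left.
Qed.

Lemma isset_may : isset (may C).
Proof.
  apply (isset_of_sub_rlm HM C).
  - unfold definable1, may; cbn. definability 1.
  - intros x Hx. apply (decides_rlm C x). now right.
Qed.

Lemma decided_rlm : decided (rlm C) (realm C).
Proof. split; [exact isset_realm|apply decides_rlm]. Qed.

Lemma decided_pos : decided C^! (pos C).
Proof.
  split; [exact isset_pos|]. intros x. unfold decides, pos; cbn. tauto.
Qed.

Lemma decided_may : decided C^? (may C).
Proof.
  split; [exact isset_may|]. intros x. unfold decides, may; cbn. tauto.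
Qed.

Lemma decided_t_part : decided (t_part C) (fun x => pos C x /\ may C x).
Proof.
  split.
  - apply (isset_sep HM); [exact isset_pos|].
    apply isset_definable, isset_may.
  - intros x. unfold decides, pos, may; cbn. tauto.
Qed.

Lemma decided_b_part : decided (b_part C) (fun x => pos C x /\ ~ may C x).
Proof.
  pose proof (isset_definable _ isset_may). split.
  - apply (isset_sep HM); [exact isset_pos|].
    unfold definable1. definability 1.
  - intros x. unfold decides, pos, may; cbn. tauto.
Qed.

Lemma decided_n_part : decided (n_part C) (fun x => may C x /\ ~ pos C x).
Proof.
  pose proof (isset_definable _ isset_pos). split.
  - apply (isset_sep HM); [exact isset_may|].
    unfold definable1. definability 1.
  - intros x. unfold decides, pos, may; cbn. tauto.
Qed.

End Parts.

(** * Assembling matchings from injections between the parts *)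

Lemma injects_refine (P Q U V : M -> Prop) :
  isset P -> isset Q -> isset U ->
  (forall x, P x -> Q x) -> (forall y, U y -> V y) ->
  injects P U -> injects Q V ->
  exists N, internal_injection N /\ total_on Q N /\
    (forall x y, N x y -> V y) /\ (forall x y, N x y -> P x -> U y).
Proof.
  intros HP HQ HU HPQ HUV [H [HH [HHP HHU]]] [K [HK [HKQ HKV]]].
  destruct (exchange HM Q P U K H HQ HP HU HK HKQ HH HHP HPQ HHU)
    as [N [HN [HNQ [HNU [HNP HNnP]]]]].
  exists N. split; [exact HN|split; [exact HNQ|split; [|exact HNU]]].
  intros x y Hxy. destruct (classic (P x)) as [Hx|Hx].
  - exact (HUV y (HNU x y Hxy Hx)).
  (* Values inherited from a source are values of [K], hence still in [V]. *)
  - destruct (HNnP x y Hxy Hx) as [Hy|[_ [s Hy]]].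
    + exact (HKV x y Hy).
    + exact (HKV s y Hy).
Qed.

Lemma dominated_iff_parts (A B : M) :
  truth (A ⪯ B) <->
  injects (realm A) (realm B) /\ injects (pos A) (pos B) /\
  injects (may A) (may B) /\
  injects (fun x => pos A x /\ may A x) (fun y => pos B y /\ may B y).
Proof.
  rewrite (dominated_true A B (isset_realm A) (isset_realm B)). split.
  - intros [H [[HH _] [H1 H2]]].
    assert (E1 := isset_realm A). assert (E2 := isset_pos A).
    assert (E3 := isset_may A). assert (E4 := proj1 (decided_t_part A)).
    split; [|split; [|split]]; eapply injects_of_forth; eauto.
    + intros x [Hx|Hx]; [destruct (H1 x Hx) as [y [Hy HBy]]|
        destruct (H2 x Hx) as [y [Hy HBy]]]; exists y; split; auto.
      * now left.
      * now right.
    (* By functionality the partner found in [B^!] and the one found in [B^?] are the same. *)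
    + intros x [Hx Hx']. destruct (H1 x Hx) as [y [Hy HBy]].
      destruct (H2 x Hx') as [z [Hz HBz]]. exists y.
      rewrite <- (internal_injection_functional H x y z HH Hy Hz) in HBz.
      auto.
  - intros [Hr [Hp [Hm Ht]]].
    destruct (injects_refine _ _ _ _ (proj1 (decided_t_part A)) (isset_pos A)
      (proj1 (decided_t_part B))
      (fun _ => @proj1 _ _) (fun _ => @proj1 _ _) Ht Hp)
      as [m1 [I1 [T1 [V1 U1]]]].
    destruct (injects_refine _ _ _ _ (proj1 (decided_t_part A)) (isset_may A)
      (proj1 (decided_t_part B))
      (fun _ => @proj2 _ _) (fun _ => @proj2 _ _) Ht Hm)
      as [m2 [I2 [T2 [V2 U2]]]].
    destruct (injects_refine _ _ _ _ (proj1 (decided_t_part A)) (isset_realm A)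
      (proj1 (decided_t_part B))
      (fun _ h => or_introl (proj1 h))
      (fun _ h => or_introl (proj1 h)) Ht Hr)
      as [l0 [I0 [T0 [V0 U0]]]].
    (* The exchange with [m1] makes [l0] send [A^!] into [B^!]; the next one, with [m2], makes the
       result send [A^?] into [B^?]. *)
    destruct (exchange HM _ _ _ l0 m1 (isset_realm A) (isset_pos A)
      (isset_pos B) I0 T0 I1 T1 (pos_realm A) V1)
      as [l1 [J1 [L1 [P1 [Q1 R1]]]]].
    destruct (exchange HM _ _ _ l1 m2 (isset_realm A) (isset_may A)
      (isset_may B) J1 L1 I2 T2 (may_realm A) V2)
      as [l2 [J2 [L2 [P2 [Q2 R2]]]]].
    assert (W1 : forall x y, l1 x y -> realm B y).
    { intros x y Hxy. destruct (classic (pos A x)) as [Hx|Hx].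
      - left. exact (P1 x y Hxy Hx).
      - destruct (R1 x y Hxy Hx) as [H|[_ [s H]]]; exact (V0 _ y H). }
    assert (Wt : forall x y, l1 x y -> pos A x -> may A x ->
      pos B y /\ may B y).
    { intros x y Hxy Hx Hx'.
      destruct (Q1 x y Hxy Hx) as [H|H]; [exact (U1 x y H (conj Hx Hx'))|].
      exact (U0 x y H (conj Hx Hx')). }
    (* The second exchange preserves the first. On [A_t] a value comes from [m2] or [l1], both of
       which lead into [B^!]. Off [A^?] a new value lies in the realm of [B] but not in [B^?], hence
       in [B^!]. *)
    assert (Wp : forall x y, l2 x y -> pos A x -> pos B y).
    { intros x y Hxy Hx. destruct (classic (may A x)) as [Hx'|Hx'].
      - destruct (Q2 x y Hxy Hx') as [H|H].
        + exact (proj1 (U2 x y H (conj Hx Hx'))).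
        + exact (P1 x y H Hx).
      - destruct (R2 x y Hxy Hx') as [H|[Hn [s H]]].
        + exact (P1 x y H Hx).
        + destruct (W1 s y H) as [G|G]; [exact G|contradiction]. }
    exists l2. split; [split; [exact J2|]|split].
    + intros x y Hxy. assert (Hx : realm A x) by (apply L2; now exists y).
      split; [exact Hx|]. destruct Hx as [Hx|Hx].
      * left. exact (Wp x y Hxy Hx).
      * right. exact (P2 x y Hxy Hx).
    + intros x Hx. destruct (proj1 (L2 x) (pos_realm A x Hx)) as [y Hy].
      exists y. split; [exact Hy|exact (Wp x y Hy Hx)].
    + intros x Hx. destruct (proj1 (L2 x) (may_realm A x Hx)) as [y Hy].
      exists y. split; [exact Hy|exact (P2 x y Hy Hx)].
Qed.

(** A matching that meets all four conditions preserves and reflects membership in both [A^!] and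
    [A^?], so it restricts to the three parts. Conversely, bijections between the parts have
    disjoint domains and disjoint ranges, and their union is a matching. *)
Lemma equinumerous_iff_parts (A B : M) :
  truth (A ≅ B) <->
  bijects (fun x => pos A x /\ may A x) (fun y => pos B y /\ may B y) /\
  bijects (fun x => pos A x /\ ~ may A x) (fun y => pos B y /\ ~ may B y) /\
  bijects (fun x => may A x /\ ~ pos A x) (fun y => may B y /\ ~ pos B y).
Proof.
  rewrite (equinumerous_true A B (isset_realm A) (isset_realm B)). split.
  - intros [H [[HH _] [[F1 F2] [B1 B2]]]].
    assert (E : forall x y, H x y ->
      (pos A x <-> pos B y) /\ (may A x <-> may B y)).
    { intros x y Hxy. split; split; intros Hx.
      - destruct (F1 x Hx) as [z [Hz G]].
        now rewrite (internal_injection_functional H x y z HH Hxy Hz).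
      - destruct (B1 y Hx) as [z [Hz G]].
        now rewrite (internal_injection_injective H x z y HH Hxy Hz).
      - destruct (F2 x Hx) as [z [Hz G]].
        now rewrite (internal_injection_functional H x y z HH Hxy Hz).
      - destruct (B2 y Hx) as [z [Hz G]].
        now rewrite (internal_injection_injective H x z y HH Hxy Hz). }
    split; [|split]; apply (bijects_of_forth_back H); auto.
    + apply (decided_t_part A).
    + intros x [Hx Hx']. destruct (F1 x Hx) as [y [Hy _]]. exists y.
      specialize (E x y Hy). tauto.
    + intros y [Hy Hy']. destruct (B1 y Hy) as [x [Hx _]]. exists x.
      specialize (E x y Hx). tauto.
    + apply (decided_b_part A).
    + intros x [Hx Hx']. destruct (F1 x Hx) as [y [Hy _]]. exists y.
      specialize (E x y Hy). tauto.
    + intros y [Hy Hy']. destruct (B1 y Hy) as [x [Hx _]]. exists x.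
      specialize (E x y Hx). tauto.
    + apply (decided_n_part A).
    + intros x [Hx Hx']. destruct (F2 x Hx) as [y [Hy _]]. exists y.
      specialize (E x y Hy). tauto.
    + intros y [Hy Hy']. destruct (B2 y Hy) as [x [Hx _]]. exists x.
      specialize (E x y Hx). tauto.
  - intros [[H1 [I1 [X1 Y1]]] [[H2 [I2 [X2 Y2]]] [H3 [I3 [X3 Y3]]]]].
    cbn beta in *.
    assert (D1 : forall x y, H1 x y ->
      (pos A x /\ may A x) /\ (pos B y /\ may B y)).
    { intros x y Hxy. split; [apply X1; now exists y|apply Y1; now exists x]. }
    assert (D2 : forall x y, H2 x y ->
      (pos A x /\ ~ may A x) /\ (pos B y /\ ~ may B y)).
    { intros x y Hxy. split; [apply X2; now exists y|apply Y2; now exists x]. }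
    assert (D3 : forall x y, H3 x y ->
      (may A x /\ ~ pos A x) /\ (may B y /\ ~ pos B y)).
    { intros x y Hxy. split; [apply X3; now exists y|apply Y3; now exists x]. }
    pose (N x y := H1 x y \/ H2 x y \/ H3 x y).
    assert (E : forall x y, N x y ->
      (pos A x <-> pos B y) /\ (may A x <-> may B y)).
    { intros x y [H|[H|H]].
      - specialize (D1 x y H). tauto.
      - specialize (D2 x y H). tauto.
      - specialize (D3 x y H). tauto. }
    assert (TX : forall x, realm A x -> exists y, N x y).
    { intros x Hx. unfold N.
      destruct (classic (pos A x)) as [Hp|Hp];
        [destruct (classic (may A x)) as [Hm|Hm]|].
      - destruct (proj1 (X1 x)) as [y Hy]; [tauto|]. exists y; tauto.
      - destruct (proj1 (X2 x)) as [y Hy]; [tauto|]. exists y; tauto.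
      - destruct (proj1 (X3 x)) as [y Hy]; [destruct Hx; tauto|].
        exists y; tauto. }
    assert (TY : forall y, realm B y -> exists x, N x y).
    { intros y Hy. unfold N.
      destruct (classic (pos B y)) as [Hp|Hp];
        [destruct (classic (may B y)) as [Hm|Hm]|].
      - destruct (proj1 (Y1 y)) as [x Hx]; [tauto|]. exists x; tauto.
      - destruct (proj1 (Y2 y)) as [x Hx]; [tauto|]. exists x; tauto.
      - destruct (proj1 (Y3 y)) as [x Hx]; [destruct Hy; tauto|].
        exists x; tauto. }
    assert (NAB : forall x y, N x y -> realm A x /\ realm B y).
    { unfold realm. intros x y [H|[H|H]].
      - specialize (D1 x y H). tauto.
      - specialize (D2 x y H). tauto.
      - specialize (D3 x y H). tauto. }
    exists N. split; [split; [|exact NAB]|].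
    + apply (internal_injection_intro HM (realm A)).
      * apply isset_realm.
      * unfold definable2, N. definability 2.
      * intros x y Hxy. apply (NAB x y Hxy).
      * intros x y z [H|[H|H]] [H'|[H'|H']].
        all: try exact (internal_injection_functional _ _ _ _ I1 H H').
        all: try exact (internal_injection_functional _ _ _ _ I2 H H').
        all: try exact (internal_injection_functional _ _ _ _ I3 H H').
        (* A mixed pair would put [x] into two different parts of [A]. *)
        all: exfalso.
        all: try specialize (D1 _ _ H); try specialize (D2 _ _ H);
          try specialize (D3 _ _ H); try specialize (D1 _ _ H');
          try specialize (D2 _ _ H'); try specialize (D3 _ _ H').
        all: tauto.
      * intros x y z [H|[H|H]] [H'|[H'|H']].
        all: try exact (internal_injection_injective _ _ _ _ I1 H H').
        all: try exact (internal_injection_injective _ _ _ _ I2 H H').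
        all: try exact (internal_injection_injective _ _ _ _ I3 H H').
        all: exfalso.
        all: try specialize (D1 _ _ H); try specialize (D2 _ _ H);
          try specialize (D3 _ _ H); try specialize (D1 _ _ H');
          try specialize (D2 _ _ H'); try specialize (D3 _ _ H').
        all: tauto.
    + split; split.
      * intros x Hx. destruct (TX x (pos_realm A x Hx)) as [y Hy].
        exists y. specialize (E x y Hy). tauto.
      * intros x Hx. destruct (TX x (may_realm A x Hx)) as [y Hy].
        exists y. specialize (E x y Hy). tauto.
      * intros y Hy. destruct (TY y (pos_realm B y Hy)) as [x Hx].
        exists x. specialize (E x y Hx). tauto.
      * intros y Hy. destruct (TY y (may_realm B y Hy)) as [x Hx].
        exists x. specialize (E x y Hx). tauto.
Qed.

Lemma not_equinumerous_iff_parts (A B : M) :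
  falsity (A ≅ B) <->
  ~ (injects (pos A) (may B) /\ injects (pos B) (may A) /\
     injects (fun x => pos A x /\ ~ may A x) (fun y => may B y /\ ~ pos B y) /\
     injects (fun y => pos B y /\ ~ may B y) (fun x => may A x /\ ~ pos A x)).
Proof.
  rewrite (equinumerous_false A B (isset_realm A) (isset_realm B)).
  apply not_iff_compat. split.
  - intros [H [[HH HAB] [HF HB]]].
    assert (HH' : internal_injection (fun y x => H x y)).
    { apply (internal_injection_converse (realm B)); auto.
      - apply isset_realm.
      - intros x y Hxy. apply (HAB x y Hxy). }
    split; [|split; [|split]].
    + apply (injects_of_forth H); auto. apply isset_pos.
    + apply (injects_of_forth (fun y x => H x y)); auto. apply isset_pos.
    + apply (injects_of_forth H); auto; [apply (decided_b_part A)|].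
      intros x [Hx Hx']. destruct (HF x Hx) as [y [Hy HBy]].
      (* If [y] were in [B^!], its partner in [A^?] would be [x] by injectivity, although [x] lies
         in [A_b]. *)
      exists y. split; [exact Hy|]. split; [exact HBy|]. intros HBy'.
      destruct (HB y HBy') as [z [Hz HAz]]. apply Hx'.
      now rewrite (internal_injection_injective H x z y HH Hy Hz).
    + apply (injects_of_forth (fun y x => H x y)); auto;
        [apply (decided_b_part B)|].
      intros y [Hy Hy']. destruct (HB y Hy) as [x [Hx HAx]].
      exists x. split; [exact Hx|]. split; [exact HAx|]. intros HAx'.
      destruct (HF x HAx') as [z [Hz HBz]]. apply Hy'.
      now rewrite (internal_injection_functional H x y z HH Hx Hz).
  - intros [I1 [I2 [I3 I4]]].
    destruct (injects_refine _ _ _ _ (proj1 (decided_b_part A)) (isset_pos A)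
      (proj1 (decided_n_part B))
      (fun _ => @proj1 _ _) (fun _ => @proj1 _ _) I3 I1)
      as [F [HF [TF [VF UF]]]].
    destruct (injects_refine _ _ _ _ (proj1 (decided_b_part B)) (isset_pos B)
      (proj1 (decided_n_part A))
      (fun _ => @proj1 _ _) (fun _ => @proj1 _ _) I4 I2)
      as [G [HG [TG [VG UG]]]].
    cbn beta in *.
    (* Every pair of the merged [H] comes from [F] or from the converse of [G], so the conditions
       can be checked on these two kinds of pairs. *)
    destruct (cover_both HM (realm A) (pos A) (pos B) F G (isset_realm A)
      (isset_pos A) HF HG TF TG (pos_realm A)
      (fun y x Hyx => may_realm A x (VG y x Hyx)))
      as [H [HH [HFG [CA CB]]]].
    assert (PF : forall x y, F x y -> pos A x).
    { intros x y Hxy. apply TF. now exists y. }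
    assert (PG : forall y x, G y x -> pos B y).
    { intros y x Hyx. apply TG. now exists x. }
    exists H. split; [split; [exact HH|]|split].
    + intros x y Hxy. destruct (HFG x y Hxy) as [Hf|Hg].
      * split; [left; exact (PF x y Hf)|right; exact (VF x y Hf)].
      * split; [right; exact (VG y x Hg)|left; exact (PG y x Hg)].
    + intros x Hx. destruct (CA x Hx) as [y Hxy]. exists y.
      split; [exact Hxy|]. destruct (HFG x y Hxy) as [Hf|Hg].
      * exact (VF x y Hf).
      (* A pair from [G] with [y] outside of [B^?] would have [y] in [B_b], which [G] maps into
         [A_n], against [x] being in [A^!]. *)
      * apply NNPP. intros Hy.
        now destruct (UG y x Hg (conj (PG y x Hg) Hy)).
    + intros y Hy. destruct (CB y Hy) as [x Hxy]. exists x.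
      split; [exact Hxy|]. destruct (HFG x y Hxy) as [Hf|Hg].
      * apply NNPP. intros Hx.
        now destruct (UF x y Hf (conj (PF x y Hf) Hx)).
      * exact (VG y x Hg).
Qed.

End Matchings.

Theorem theorem4p5 (M : model) (HM : BZFC M) (A B : M) :
  (truth (A ⪯ B) <->
     truth (rlm A ⪯ rlm B) /\ truth (A^! ⪯ B^!) /\
     truth (A^? ⪯ B^?) /\ truth (t_part A ⪯ t_part B)) /\
  (truth (A ⋠ B) <-> truth (A^! ⋠ B^?)) /\
  (truth (A ≅ B) <->
     truth (t_part A ≅ t_part B) /\ truth (b_part A ≅ b_part B) /\
     truth (n_part A ≅ n_part B)) /\
  (truth (A ≇ B) <->
     truth (A^! ⋠ B^?) \/ truth (B^! ⋠ A^?) \/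
     truth (b_part A ⋠ n_part B) \/ truth (b_part B ⋠ n_part A)).
Proof.
  pose proof (decided_rlm HM) as Dr. pose proof (decided_pos HM) as Dp.
  pose proof (decided_may HM) as Dm. pose proof (decided_t_part HM) as Dt.
  pose proof (decided_b_part HM) as Db. pose proof (decided_n_part HM) as Dn.
  split; [|split; [|split]].
  - rewrite (decided_dominated_true HM _ _ _ _ (Dr A) (Dr B)).
    rewrite (decided_dominated_true HM _ _ _ _ (Dp A) (Dp B)).
    rewrite (decided_dominated_true HM _ _ _ _ (Dm A) (Dm B)).
    rewrite (decided_dominated_true HM _ _ _ _ (Dt A) (Dt B)).
    apply (dominated_iff_parts HM).
  - change (falsity (A ⪯ B) <-> falsity (A^! ⪯ B^?)).
    rewrite (decided_dominated_false HM _ _ _ _ (Dp A) (Dm B)).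
    rewrite (dominated_false HM A B (isset_realm HM A) (isset_realm HM B)).
    apply not_iff_compat, (matching_injects HM).
    + exact (isset_pos HM A).
    + exact (pos_realm A).
    + exact (may_realm B).
  - rewrite (decided_equinumerous_true HM _ _ _ _ (Dt A) (Dt B)).
    rewrite (decided_equinumerous_true HM _ _ _ _ (Db A) (Db B)).
    rewrite (decided_equinumerous_true HM _ _ _ _ (Dn A) (Dn B)).
    apply (equinumerous_iff_parts HM).
  - change (falsity (A ≅ B) <->
      falsity (A^! ⪯ B^?) \/ falsity (B^! ⪯ A^?) \/
      falsity (b_part A ⪯ n_part B) \/ falsity (b_part B ⪯ n_part A)).
    rewrite (decided_dominated_false HM _ _ _ _ (Dp A) (Dm B)).
    rewrite (decided_dominated_false HM _ _ _ _ (Dp B) (Dm A)).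
    rewrite (decided_dominated_false HM _ _ _ _ (Db A) (Dn B)).
    rewrite (decided_dominated_false HM _ _ _ _ (Db B) (Dn A)).
    rewrite (not_equinumerous_iff_parts HM A B). tauto.
Qed.
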